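(* Let $K$ and $L$ be compact lines, let $\phi:K\to L$ be a continuous increasing surjection, let $I$ be a set and let $T:C(L)\to c_0(I)$ be a bounded linear operator. If there exists a bounded linear operator $S:C(K)\to c_0(I)$ with $S\circ\phi^*=T$, then there exists a bounded linear operator $S':C(K)\to c_0(I)$ with $S'\circ\phi^*=T$ and $\Vert S'\Vert\le2\Vert T\Vert$.
   Context: A compact line is a totally ordered set which is compact in its order topology. $C(K)$ denotes the Banach space of real continuous functions on $K$ with the sup norm. $c_0(I)$ is the Banach space (sup norm) of real families $(a_i)_{i\in I}$ such that $\{i:|a_i|\ge\varepsilon\}$ is finite for every $\varepsilon>0$. The composition operator $\phi^*:C(L)\to C(K)$ is $\phi^*(f)=f\circ\phi$. *)

(* Defs.v *)
From HB Require Import structures.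
From mathcomp Require Import all_boot all_order all_algebra.
From mathcomp Require Import all_classical all_reals all_analysis.
Set Implicit Arguments. Unset Strict Implicit. Unset Printing Implicit Defensive.
Import Order.TTheory GRing.Theory Num.Theory numFieldTopology.Exports numFieldNormedType.Exports.
Local Open Scope classical_set_scope.
Local Open Scope ring_scope.

Definition supnorm (R : realType) (X : Type) (f : X -> R) : R :=
  sup (range (fun x => `|f x|)).

Definition in_c0 (R : realType) (I : Type) (a : I -> R) : Prop :=
  forall eps : R, 0 < eps -> finite_set [set i | eps <= `|a i|].

Definition inC (R : realType) (K : topologicalType) (f : K -> R) : Prop :=
  continuous f.

(* T is a bounded linear operator C(K) -> c_0(I).  T is given as a map on all
   functions K -> R, only its restriction to C(K) matters. *)
Definition bdd_lin_op_C_c0 (R : realType) (K : topologicalType) (I : Type)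
    (T : (K -> R) -> (I -> R)) : Prop :=
  [/\ (forall f, inC f -> in_c0 (T f)),
      (forall (a : R) (f g : K -> R), inC f -> inC g ->
         T (fun x => a * f x + g x) = (fun i => a * T f i + T g i)) &
      (exists M : R, forall f, inC f -> supnorm (T f) <= M * supnorm f)].

Definition opnorm (R : realType) (K : topologicalType) (I : Type)
    (T : (K -> R) -> (I -> R)) : R :=
  sup [set r | exists f : K -> R, [/\ inC f, supnorm f <= 1 & r = supnorm (T f)]].

Definition comp_op (K L : Type) (R : Type) (phi : K -> L) (f : L -> R) : K -> R :=
  f \o phi.

(* Main.v *)
Require Import Defs.
From HB Require Import structures.
From mathcomp Require Import all_boot all_order all_algebra.
From mathcomp Require Import all_classical all_reals all_analysis.
From mathcomp Require Import ring lra.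
Import Order.TTheory GRing.Theory Num.Theory numFieldTopology.Exports numFieldNormedType.Exports.
Local Open Scope classical_set_scope.
Local Open Scope ring_scope.

(* Write mu_i, nu_i for the functionals given by the i-th coordinates of S, T,
   and let [a_y, b_y] be the fibre of phi over y. Only the y with a_y < b_y
   matter; for these pick e_y : K -> [0,1] continuous, 0 up to a_y and 1 from b_y
   on. Finite interpolation along b and a limit over an ultrafilter extend nu_i
   from C(L) to a functional lambda_i on C(K) without enlarging the norm. Such
   extensions need not be c_0-valued: the obstruction is the family
   rho_i(y) = mu_i(e_y) - lambda_i(e_y).

   The bound 2 comes from the following estimate. For y_1 < ... < y_n there are
   g_j in C(L) with sum_j |2 e_{y_j} - g_j o phi| <= 1, and mu_i, lambda_i agree
   on g_j o phi, hence 2 sum_j |rho_i(y_j)| <= |T| + o(1), where the o(1) is in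
   c_0(I). So up to o(1) every rho_i has mass at most |T|/2 on any given finite
   set, and it can be replaced by some rho'_i of mass at most |T|/2 such that
   rho_i(y) - rho'_i(y) is in c_0(I) for every y. This selection uses that every
   y meets only countably many supports: nu_i has almost no variation on a
   one-sided neighbourhood of y that depends on i, and since T takes
   values in c_0(I), only finitely many i with rho_i(y) large can share a
   neighbourhood. Then
   S'f(i) = lambda_i(f) + sum_y rho'_i(y) (f(b_y) - f(a_y)) has norm <= 2|T|. *)

(** * Order and compactness facts about compact lines *)

Section CompactLine.
Set Implicit Arguments.
Unset Strict Implicit.
Context {R : realType} {d : Order.disp_t} {X : orderTopologicalType d}.
Implicit Types (x y z p q : X) (A U : set X) (f g h : X -> R).

Lemma nbhs_left_ray x U z : nbhs x U -> (z < x)%O ->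
  exists2 p, (p < x)%O & forall t, (p < t)%O -> (t <= x)%O -> U t.
Proof.
rewrite itv_nbhsE => -[[l r] [oi xi] iU] zx.
case: l oi xi iU => [b p|b] oi xi iU; last first.
  move: (itv_open_ends_linfty oi) => bE; subst b.
  exists z => // t _ tx; apply: iU => /=.
  by move: xi; rewrite !itv_boundlr /= => xr; exact: le_trans xr.
move: (itv_open_ends_lside oi) => bE; subst b.
have /andP[px xr] : ((p < x)%O && (BRight x <= r)%O) by move: xi; rewrite itv_boundlr.
exists p => // t pt tx; apply: iU; rewrite /= itv_boundlr; apply/andP; split=> //.
exact: le_trans xr.
Qed.

Lemma nbhs_convex x U : nbhs x U -> exists V : set X,
  [/\ nbhs x V, V `<=` U &
      forall a b c, V a -> V b -> (a <= c)%O -> (c <= b)%O -> V c].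
Proof.
rewrite itv_nbhsE => -[i [oi xi] iU]; exists [set` i]; split=> //.
  by exists i.
move=> a b c; case: i {oi xi iU} => l r /=.
rewrite !itv_boundlr => /andP[la _] /andP[_ br] ac cb; apply/andP; split.
  exact: le_trans la _.
exact: le_trans br.
Qed.

(** A point of [V] below [x] serves as [p] if there is one. Otherwise [V] lies in [x, +oo[, so this
    ray is a neighbourhood of [x] and [p] is [x] itself. *)
Lemma nbhs_ge_left x (V : set X) : nbhs x V ->
  exists p, [/\ (p <= x)%O, V p & nbhs x [set t | (p <= t)%O]].
Proof.
move=> Vx; have [[p [px Vp]]|nV] := pselect (exists p, (p < x)%O /\ V p).
  exists p; split; [exact: ltW|exact: Vp|].
  have : nbhs x `]p, +oo[%classic by apply: open_nbhs_nbhs; split; [exact: rray_open|rewrite /= in_itv /= px].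
  by apply: filterS => t /=; rewrite in_itv /= andbT => /ltW.
exists x; split=> //; first exact: nbhs_singleton.
apply: filterS Vx => t Vt /=; rewrite leNgt; apply/negP => tx; apply: nV.
by exists t.
Qed.

Lemma nbhs_le_right x (V : set X) : nbhs x V ->
  exists p, [/\ (x <= p)%O, V p & nbhs x [set t | (t <= p)%O]].
Proof.
move=> Vx; have [[p [px Vp]]|nV] := pselect (exists p, (x < p)%O /\ V p).
  exists p; split; [exact: ltW|exact: Vp|].
  have : nbhs x `]-oo, p[%classic by apply: open_nbhs_nbhs; split; [exact: lray_open|rewrite /= in_itv /= px].
  by apply: filterS => t /=; rewrite in_itv /= => /ltW.
exists x; split=> //; first exact: nbhs_singleton.
apply: filterS Vx => t Vt /=; rewrite leNgt; apply/negP => tx; apply: nV.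
by exists t.
Qed.

Hypothesis cX : compact [set: X].

(** The final segments of [A] generate a proper filter; compactness gives it a cluster point, which
    lies in [A] and is exceeded by no element of [A]. *)
Lemma closed_has_max A : closed A -> A !=set0 ->
  exists2 m, A m & forall x, A x -> (x <= m)%O.
Proof.
move=> cA A0; pose F := filter_from A (fun a => [set x | A x /\ (a <= x)%O]).
have FF : ProperFilter F.
  apply: filter_from_proper; last by move=> a Aa; exists a.
  apply: filter_from_filter => // a b Aa Ab; exists (Order.max a b).
    by case: (leP a b).
  by move=> x [Ax]; rewrite ge_max => /andP[].
have [//|m [_ mF]] := cX FF; first exact: filterT.
exists m.
  rewrite closure_id in cA; rewrite cA => B nB.
  have [a Aa] := A0; have [|x [[Ax _] Bx]] := mF [set x | A x /\ (a <= x)%O] B _ nB.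
    by exists a.
  by exists x.
move=> x Ax; rewrite leNgt; apply/negP => mx.
have [|| t [[_]]] := mF [set t | A t /\ (x <= t)%O] `]-oo, x[%classic.
- by exists x.
- by apply: open_nbhs_nbhs; split; [exact: lray_open|rewrite /= in_itv].
- by rewrite /= in_itv /= => xt /(le_lt_trans xt); rewrite ltxx.
Qed.

Lemma closed_has_min A : closed A -> A !=set0 ->
  exists2 m, A m & forall x, A x -> (m <= x)%O.
Proof.
move=> cA A0; pose F := filter_from A (fun a => [set x | A x /\ (x <= a)%O]).
have FF : ProperFilter F.
  apply: filter_from_proper; last by move=> a Aa; exists a.
  apply: filter_from_filter => // a b Aa Ab; exists (Order.min a b).
    by case: (leP a b).
  by move=> x [Ax]; rewrite le_min => /andP[].
have [//|m [_ mF]] := cX FF; first exact: filterT.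
exists m.
  rewrite closure_id in cA; rewrite cA => B nB.
  have [a Aa] := A0; have [|x [[Ax _] Bx]] := mF [set x | A x /\ (x <= a)%O] B _ nB.
    by exists a.
  by exists x.
move=> x Ax; rewrite leNgt; apply/negP => mx.
have [|| t [[_]]] := mF [set t | A t /\ (t <= x)%O] `]x, +oo[%classic.
- by exists x.
- by apply: open_nbhs_nbhs; split; [exact: rray_open|rewrite /= in_itv /= mx].
- by rewrite /= in_itv /= andbT => xt xt'; move: (lt_le_trans xt' xt); rewrite ltxx.
Qed.

(** Urysohn's lemma for two disjoint closed rays, a compact Hausdorff space being normal. *)
Lemma compact_line_separation u v : (u < v)%O -> exists f : X -> R,
  [/\ continuous f, (forall t, 0 <= f t <= 1),
      (forall t, (t <= u)%O -> f t = 0) & (forall t, (v <= t)%O -> f t = 1)].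
Proof.
move=> uv.
have nX : normal_space X by apply: compact_normal => //; exact: order_hausdorff.
have AB0 : `]-oo, u]%classic `&` `[v, +oo[%classic = set0 :> set X.
  rewrite -subset0 => t [] /=; rewrite !in_itv /= andbT => tu vt.
  by have := lt_le_trans uv (le_trans vt tu); rewrite ltxx.
move/normal_separatorP : nX => /(_ R _ _ (@lray_closed _ _ u) (@rray_closed _ _ v) AB0).
move=> /(@uniform_separatorP _ R)[f [cf f01 f0 f1]]; exists f; split=> //.
- by move=> t; have := f01 (f t) (ex_intro2 _ _ t I erefl); rewrite /= in_itv.
- by move=> t tu; apply: f0; exists t => //=; rewrite in_itv.
- by move=> t vt; apply: f1; exists t => //=; rewrite in_itv /= vt.
Qed.

(** If no finite list worked, the sets of bad points would generate a filter with a cluster point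
    [x]. Two points [p], [q] bracketing [x] in a small convex neighbourhood then serve all points
    near [x], a contradiction. *)
Lemma finite_oscillation f (e : R) : continuous f -> 0 < e ->
  exists s : seq X, forall x, exists p q,
    [/\ p \in s, q \in s, (p <= x)%O, (x <= q)%O &
        forall t, (p <= t)%O -> (t <= q)%O -> `|f t - f x| <= e].
Proof.
move=> cf e0.
pose good (s : seq X) x := exists p q,
    [/\ p \in s, q \in s, (p <= x)%O, (x <= q)%O &
        forall t, (p <= t)%O -> (t <= q)%O -> `|f t - f x| <= e].
have goodS s s' x : {subset s <= s'} -> good s x -> good s' x.
  by move=> ss' [p [q [ps qs px xq pq]]]; exists p, q; split=> //; exact: ss'.
apply: contrapT => /forallNP bad.
have {}bad s : exists x, ~ good s x by apply/existsNP; exact: bad.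
pose F := filter_from [set: seq X] (fun s => [set x | ~ good s x]).
have FF : ProperFilter F.
  apply: filter_from_proper; last by move=> s _; have [x] := bad s; exists x.
  apply: filter_from_filter; first by exists [::].
  move=> s s' _ _; exists (s ++ s') => // x nx; split; apply: contra_not nx.
    by apply: goodS => y; rewrite mem_cat => ->.
  by apply: goodS => y; rewrite mem_cat orbC => ->.
have [//|x [_ xF]] := cX FF; first exact: filterT.
have e20 : 0 < e / 2 by rewrite divr_gt0.
have nU : nbhs x [set t | `|f x - f t| < e / 2].
  by have := cf x _ (nbhsx_ballx (f x) (e / 2) e20).
have [V [nV VU cV]] := nbhs_convex nU.
have [p [px Vp np]] := nbhs_ge_left nV.
have [q [xq Vq nq]] := nbhs_le_right nV.
have [|y [ny [/= py yq]]] := xF [set y | ~ good [:: p; q] y] _ _ (filterI np nq).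
  by exists [:: p; q].
apply: ny; exists p, q; split; rewrite ?inE ?eqxx ?orbT // => t pt tq.
have /VU /= ft := cV _ _ _ Vp Vq pt tq.
have /VU /= fy := cV _ _ _ Vp Vq py yq.
move: ft fy; rewrite !ltr_norml ler_norml => /andP[? ?] /andP[? ?].
by apply/andP; split; lra.
Qed.

Lemma compact_line_bounded f : continuous f -> exists B, forall x, `|f x| <= B.
Proof.
move=> cf; have [s sP] := finite_oscillation cf ltr01.
exists (\sum_(p <- s) `|f p| + 1) => x.
have [p [q [ps _ px xq pq]]] := sP x.
have fp : `|f p| <= \sum_(p <- s) `|f p|.
  by rewrite (big_rem p) //= lerDl sumr_ge0.
have := pq p (lexx _) (le_trans px xq).
have := ler_distD (f p) (f x) 0; rewrite !subr0 => h1; rewrite distrC; lra.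
Qed.

End CompactLine.

(** * Bounded linear functionals on spaces of continuous functions *)

Section BoundedFunctionals.
Set Implicit Arguments.
Unset Strict Implicit.

(** The norm bound is stated against any uniform bound [c] of [f], which avoids suprema. *)
Definition bounded_functional (R : realType) (X : topologicalType)
    (nu : (X -> R) -> R) (m : R) : Prop :=
  [/\ 0 <= m,
      (forall (a : R) (f g : X -> R), continuous f -> continuous g ->
         nu (fun x => a * f x + g x) = a * nu f + nu g) &
      (forall (f : X -> R) (c : R), continuous f -> 0 <= c -> (forall x, `|f x| <= c) ->
         `|nu f| <= m * c)].

Context {R : realType} {X : topologicalType}.
Implicit Types (f g h : X -> R) (nu : (X -> R) -> R) (a c m : R).

Lemma continuous_scaleD a f g : continuous f -> continuous g ->
  continuous (fun x => a * f x + g x).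
Proof.
by move=> cf cg x; apply: cvgD; [apply: cvgM; [exact: cvg_cst|exact: cf]|exact: cg].
Qed.

Lemma continuous_cst_fun c : continuous (fun _ : X => c).
Proof. by move=> x; exact: cvg_cst. Qed.

Lemma continuous_sumZ (J : Type) (s : seq J) (c : J -> R) (G : J -> X -> R) :
  (forall j, continuous (G j)) ->
  continuous (fun x => \sum_(j <- s) c j * G j x).
Proof.
move=> cG; elim: s => [|j s IH].
  by under eq_fun do rewrite big_nil; exact: continuous_cst_fun.
by under eq_fun do rewrite big_cons; exact: continuous_scaleD.
Qed.

Variables (nu : (X -> R) -> R) (m : R).
Hypothesis nuP : bounded_functional nu m.

Lemma functional0 : nu (fun=> 0) = 0.
Proof.
have [_ lin _] := nuP; have := lin (- 1) _ _ (@continuous_cst_fun 0) (@continuous_cst_fun 0).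
rewrite [X in _ = X](_ : _ = 0); last by rewrite mulN1r addNr.
by move=> nu0; rewrite -[RHS]nu0; congr nu; apply/funext => x; rewrite mulr0 addr0.
Qed.

Lemma functionalD f g : continuous f -> continuous g ->
  nu (fun x => f x + g x) = nu f + nu g.
Proof.
move=> cf cg; have [_ lin _] := nuP; rewrite -[nu f]mul1r -lin //.
by congr nu; apply/funext => x; rewrite mul1r.
Qed.

Lemma functionalZ a f : continuous f -> nu (fun x => a * f x) = a * nu f.
Proof.
move=> cf; have [_ lin _] := nuP.
rewrite -[RHS]addr0 -functional0 -lin //; last exact: continuous_cst_fun.
by congr nu; apply/funext => x; rewrite addr0.
Qed.

Lemma functionalB f g : continuous f -> continuous g ->
  nu (fun x => f x - g x) = nu f - nu g.
Proof.
move=> cf cg; have [_ lin _] := nuP; rewrite addrC -mulN1r -lin //.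
by congr nu; apply/funext => x; rewrite mulN1r addrC.
Qed.

Lemma functional_sumZ (J : Type) (s : seq J) (c : J -> R) (G : J -> X -> R) :
  (forall j, continuous (G j)) ->
  nu (fun x => \sum_(j <- s) c j * G j x) = \sum_(j <- s) c j * nu (G j).
Proof.
move=> cG; have [_ lin _] := nuP; elim: s => [|j s IH].
  by rewrite [RHS]big_nil -[RHS]functional0; congr nu; apply/funext => x; rewrite big_nil.
rewrite big_cons -IH -lin //; last exact: continuous_sumZ.
by congr nu; apply/funext => x; rewrite big_cons.
Qed.

Lemma functional_le1 f : continuous f -> (forall x, `|f x| <= 1) -> `|nu f| <= m.
Proof. by move=> cf f1; have [_ _ /(_ f 1 cf ler01 f1)] := nuP; rewrite mulr1. Qed.

End BoundedFunctionals.

(** * Small variation of a functional to the left of a point *)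

Section Variation.
Set Implicit Arguments.
Unset Strict Implicit.
Context {R : realType} {d : Order.disp_t} {X : orderTopologicalType d}.

(** Soft thresholding: for [e >= 0], [u] minus its truncation to [-e, e]. *)
Let shrink (e u : R) : R := u - (`|u + e| - `|u - e|) / 2.

Let shrinkP (e u : R) : 0 <= e ->
  [/\ `|u| <= e -> shrink e u = 0, `|shrink e u| <= `|u| & `|u - shrink e u| <= e].
Proof.
move=> e0; rewrite /shrink ler_norml.
have [h1|h1] := lerP 0 (u + e); have [h2|h2] := lerP 0 (u - e);
  rewrite ?(ger0_norm h1) ?(ltr0_norm h1) ?(ger0_norm h2) ?(ltr0_norm h2);
  have [h3|h3] := lerP 0 u;
  rewrite ?(ger0_norm h3) ?(ltr0_norm h3); split=> //;
  try (move=> /andP[? ?]); try (rewrite ler_norml; apply/andP; split); lra.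
Qed.

(* Functions of norm at most 1 with pairwise disjoint supports in successive
   intervals add up to a function of norm at most 1, so only boundedly many of
   them can have a large image. *)
Lemma variation_left (nu : (X -> R) -> R) (m : R) (y z0 : X) (e : R) :
  bounded_functional nu m -> (z0 < y)%O -> 0 < e ->
  exists2 z, (z < y)%O & forall h : X -> R, continuous h ->
    (forall t, `|h t| <= 1) ->
    (forall t, h t != 0 -> (z < t)%O /\ (t < y)%O) -> `|nu h| <= e.
Proof.
move=> nuP z0y e0; apply: contrapT => no.
have [m0 lin bd] := nuP.
have large z : (z < y)%O -> exists h : X -> R, [/\ continuous h, (forall t, `|h t| <= 1),
    (forall t, h t != 0 -> (z < t)%O /\ (t < y)%O) & e < nu h].
  move=> zy; apply: contrapT => nh; apply: no; exists z => // h ch h1 hz.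
  rewrite leNgt; apply/negP => eh; apply: nh.
  have [n0|n0] := lerP 0 (nu h).
    by exists h; split=> //; move: eh; rewrite ger0_norm.
  exists (fun t => - 1 * h t + 0); split.
  - by apply: continuous_scaleD => //; exact: continuous_cst_fun.
  - by move=> t; rewrite addr0 mulN1r normrN.
  - by move=> t; rewrite addr0 mulN1r oppr_eq0; exact: hz.
  - rewrite lin //; last exact: continuous_cst_fun.
    by rewrite (functional0 nuP) addr0 mulN1r; move: eh; rewrite ltr0_norm.
(* Thresholding at [eta] changes [nu h] by at most [m * eta <= e / 2]. *)
pose eta := e / 2 / (m + 1).
have m10 : 0 < m + 1 by rewrite ltr_wpDl.
have eta0 : 0 < eta by rewrite !divr_gt0.
have etam : m * eta <= e / 2.
  rewrite /eta mulrCA; apply: ler_piMr; first by rewrite ltW ?divr_gt0.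
  by rewrite ler_pdivrMr // mul1r lerDl.
(* Since [h] vanishes at [y], it is at most [eta] in modulus near [y]. Thresholding makes it zero
   there and leaves room before [y] for the next function. *)
have step z : (z < y)%O -> exists z', (z <= z')%O /\ (z' < y)%O /\ exists h : X -> R,
    [/\ continuous h, (forall t, `|h t| <= 1),
    (forall t, h t != 0 -> (z < t)%O /\ (t <= z')%O) & e / 2 <= nu h].
  move=> zy; have [h [ch h1 hz eh]] := large z zy.
  have hy : h y = 0 by apply/eqP/negPn/negP => /hz []; rewrite ltxx.
  have [z' z'y near_y] : exists2 p, (p < y)%O &
      forall t, (p < t)%O -> (t <= y)%O -> `|h t| <= eta.
    apply: (nbhs_left_ray (U := [set t | `|h t| <= eta]) _ zy).
    have nb : nbhs y [set t | `|h y - h t| < eta].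
      by have := ch y _ (nbhsx_ballx (h y) eta eta0).
    by apply: filterS nb => t /=; rewrite hy sub0r normrN => /ltW.
  have cs : continuous (fun t => shrink eta (h t)).
    have -> : (fun t => shrink eta (h t)) =
       (fun t => - (1 / 2) * `|h t + eta| + ((1 / 2) * `|h t - eta| + h t)).
      by apply/funext => t; rewrite /shrink; lra.
    apply: continuous_scaleD; last apply: continuous_scaleD => //.
      by move=> t; apply: cvg_norm; apply: cvgD; [exact: ch|exact: cvg_cst].
    by move=> t; apply: cvg_norm; apply: cvgD; [exact: ch|exact: cvg_cst].
  exists (Order.max z z'); split; first by rewrite le_max lexx.
  split; first by rewrite gt_max zy.
  exists (fun t => shrink eta (h t)); split=> //.
  - by move=> t; have [_ + _] := shrinkP (h t) (ltW eta0); move/le_trans; apply.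
  - move=> t; have [sh0 _ _] := shrinkP (h t) (ltW eta0) => st0.
    have : h t != 0.
      apply: contra_neq st0 => ht; apply: sh0; rewrite ht normr0; exact: ltW.
    move=> /hz [zt ty]; split=> //; rewrite le_max orbC leNgt.
    apply/orP; left; apply/negP => z't; move/eqP: st0; apply; apply: sh0.
    by apply: near_y => //; exact: ltW.
  - have : `|nu (fun t => h t - shrink eta (h t))| <= m * eta.
      apply: bd; [|exact: ltW|by move=> t; have [] := shrinkP (h t) (ltW eta0)].
      by move=> t; apply: cvgB; [exact: ch|exact: cs].
    rewrite (functionalB nuP) // ler_norml => /andP[_ h2]; lra.
have many n z : (z < y)%O -> exists h : X -> R,
    [/\ continuous h, (forall t, `|h t| <= 1),
    (forall t, h t != 0 -> (z < t)%O) & n%:R * (e / 2) <= nu h].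
  elim: n z => [|n IH] z zy.
    exists (fun=> 0); split; [exact: continuous_cst_fun| | |].
    - by move=> t; rewrite normr0.
    - by move=> t; rewrite eqxx.
    - by rewrite mul0r (functional0 nuP).
  have [z' [zz' [z'y [h [ch h1 hz eh]]]]] := step z zy.
  have [g [cg g1 gz eg]] := IH z' z'y.
  exists (fun t => h t + g t); split.
  - by move=> t; apply: cvgD; [exact: ch|exact: cg].
  - move=> t; have [->|/gz z't] := eqVneq (g t) 0; first by rewrite addr0.
    suff -> : h t = 0 by rewrite add0r.
    by apply/eqP/negPn/negP => /hz [_]; rewrite leNgt z't.
  - move=> t; have [->|/hz []//] := eqVneq (h t) 0; rewrite add0r => /gz.
    exact: le_lt_trans.
  - by rewrite (functionalD nuP) // -natr1 mulrDl mul1r addrC lerD.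
have e20 : 0 < e / 2 by rewrite divr_gt0.
have := archi_boundP (divr_ge0 m0 (ltW e20)).
have [h [ch h1 _ hn]] := many (Num.bound (m / (e / 2))) z0 z0y.
rewrite ltr_pdivrMr // => mn.
have := functional_le1 nuP ch h1; rewrite ler_norml => /andP[_ h2].
by have := lt_le_trans mn (le_trans hn h2); rewrite ltxx.
Qed.

End Variation.

(** * Criteria for countability and finiteness *)

Section Countability.
Set Implicit Arguments.
Unset Strict Implicit.

(** An injective sequence [q] in an infinite [B] is cofinal under [z], since otherwise all its terms
    would lie in one finite initial segment. So [B] is a countable union of finite segments. *)
Lemma countable_small_initial_segments (d : Order.disp_t) (X : orderType d)
    (I : Type) (B : set I) (z : I -> X) :
  (forall i, B i -> finite_set [set j | B j /\ (z j <= z i)%O]) -> countable B.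
Proof.
elim/Ppointed: I => I in B z *; first by rewrite emptyE.
move=> fin; have [/finite_set_countable//|] := pselect (finite_set B).
move=> /infiniteP/pcard_leP/injfunPex[/= q qB q_inj].
have cofinal i : B i -> exists n, (z i <= z (q n))%O.
  move=> Bi; apply: contrapT => /forallNP nle.
  apply: infinite_nat; apply: (sub_finite_set _ (finite_preimage (f := q) _ (fin i Bi))).
    by move=> n _ /=; split; [exact: qB|have /negP := nle n; rewrite -ltNge => /ltW].
  by move=> a b _ _; apply: q_inj; exact: in_setT.
apply: (@sub_countable _ _ _ (\bigcup_(n in [set: nat]) [set j | B j /\ (z j <= z (q n))%O])).
  apply: subset_card_le => i Bi; have [n zin] := cofinal i Bi; by exists n.
by apply: bigcup_countable => // n _; apply/finite_set_countable/fin/qB.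
Qed.

Context {R : realType}.

Lemma bounded_sums_finite (J : choiceType) (r : J -> R) (B e : R) : 0 < e ->
  (forall s, uniq s -> \sum_(y <- s) `|r y| <= B) ->
  finite_set [set y | e <= `|r y|].
Proof.
move=> e0 rB; apply: contrapT => inf.
have [F FA sF] := infinite_set_fset (Num.bound (B / e)) inf.
have B0 : 0 <= B by have := rB [::] isT; rewrite big_nil.
have := archi_boundP (divr_ge0 B0 (ltW e0)); rewrite ltr_pdivrMr // ltNge => /negP; apply.
apply: le_trans (rB _ (finmap.fset_uniq F)).
apply: (@le_trans _ _ (\sum_(y <- finmap.enum_fset F) e)).
  rewrite big_const_seq count_predT iter_addr_0 -[leRHS]mulr_natl; apply: ler_wpM2r; first exact: ltW.
  by rewrite ler_nat.
by rewrite big_seq [leRHS]big_seq; apply: ler_sum => y yF; apply: FA.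
Qed.

Lemma countable_nonzero (J : Type) (r : J -> R) :
  (forall e, 0 < e -> countable [set y | e <= `|r y|]) ->
  countable [set y | r y != 0].
Proof.
move=> cr; pose e n : R := n.+1%:R^-1.
apply: (@sub_countable _ _ _ (\bigcup_(n in [set: nat]) [set y | e n <= `|r y|])).
  apply: subset_card_le => y /= ry.
  have ry0 : 0 < `|r y| by rewrite normr_gt0.
  have := archi_boundP (ltW (divr_gt0 ltr01 ry0)).
  set n := Num.bound _ => yn; exists n => //=; rewrite /e invf_ple ?posrE //.
  by rewrite -div1r (le_trans (ltW yn)) // ler_nat.
by apply: bigcup_countable => // n _; apply: cr; rewrite invr_gt0.
Qed.

Lemma ler_sum_uniq_sub (J : eqType) (s t : seq J) (r : J -> R) :
  (forall y, 0 <= r y) -> uniq s -> {subset s <= t} ->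
  \sum_(y <- s) r y <= \sum_(y <- t) r y.
Proof.
move=> r0; elim: s t => [|x s IH] t.
  by move=> _ _; rewrite big_nil sumr_ge0.
move=> /= /andP[xs us] st; rewrite big_cons [leRHS](big_rem x) /=; last first.
  by apply: st; rewrite inE eqxx.
rewrite lerD2l IH // => y ys; have yt : y \in t by apply: st; rewrite inE ys orbT.
have [yx|yx] := eqVneq y x; first by rewrite -yx ys in xs.
by move: yt; rewrite (perm_mem (perm_to_rem (st x (mem_head _ _)))) inE (negPf yx).
Qed.

Lemma seq_argmax (J : eqType) (f : J -> nat) (s : seq J) : s != [::] ->
  exists2 y, y \in s & forall z, z \in s -> (f z <= f y)%N.
Proof.
elim: s => // x s IH _; have [->|/IH [y ys ymax]] := eqVneq s [::].
  by exists x; [rewrite mem_head|move=> z; rewrite inE => /eqP ->].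
have [xy|yx] := leqP (f x) (f y).
  exists y; first by rewrite inE ys orbT.
  by move=> z; rewrite inE => /predU1P[->//|/ymax].
exists x; first exact: mem_head.
by move=> z; rewrite inE => /predU1P[->//|/ymax zy]; exact: leq_trans zy (ltnW yx).
Qed.

End Countability.

(** * Truncating the rows of a matrix with countable rows and columns *)

Section Selection.
Set Implicit Arguments.
Unset Strict Implicit.
Context {R : realType} {I : Type} {J : choiceType}.
Variable r : I -> J -> R.
Hypothesis row_countable : forall i, countable [set y | r i y != 0].
Hypothesis col_countable : forall y, countable [set i | r i y != 0].

(** Call two columns adjacent if some row is nonzero at both. [spread A] collects the columns
    adjacent to one in [A], and [comp y] is the connected component of [y]. *)
Let spread (A : set J) : set J :=
  \bigcup_(y in A) \bigcup_(i in [set i | r i y != 0]) [set z | r i z != 0].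
Let comp (y : J) : set J := \bigcup_(n in [set: nat]) iter n spread [set y].

Let countable_comp y : countable (comp y).
Proof.
apply: bigcup_countable => // n _; elim: n => [|n IH] /=; first exact: countable1.
by apply: bigcup_countable => // z _; apply: bigcup_countable.
Qed.

Let comp_refl y : comp y y.
Proof. by exists 0%N. Qed.

Let comp_step y a b i : comp y a -> r i a != 0 -> r i b != 0 -> comp y b.
Proof.
by move=> [n _ na] ia ib; exists n.+1 => //=; exists a => //; exists i.
Qed.

Let comp_min y (A : set J) : A y ->
  (forall a b i, A a -> r i a != 0 -> r i b != 0 -> A b) -> comp y `<=` A.
Proof.
move=> Ay Astep z [n _]; elim: n z => [|n IH] z /=; first by move=> ->.
by move=> [a /IH Aa [i ia iz]]; exact: Astep Aa ia iz.
Qed.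

Let comp_sub y z : comp y z -> comp z `<=` comp y.
Proof. by move=> yz; apply: comp_min => // a b i; exact: comp_step. Qed.

(** Adjacency is symmetric, so a chain from [y] to [z] can be run backwards. *)
Let comp_eq y z : comp y z -> comp z = comp y.
Proof.
move=> yz; apply/seteqP; split; first exact: comp_sub.
apply: comp_sub; move: z yz; apply: comp_min => [|a b i aC ia ib]; first exact: comp_refl.
exact: (comp_sub (comp_step (comp_refl b) ib ia)) aC.
Qed.

Let clip (c u : R) : R := Num.min c (Num.max (- c) u).

Let clipP (c u : R) : 0 <= c ->
  [/\ `|clip c u| <= `|u|, `|clip c u| <= c &
      `|u - clip c u| <= Num.max 0 (`|u| - c)].
Proof.
move=> c0; rewrite /clip.
have [h1|h1] := leP (- c) u; [have [h2|h2] := leP c u|have [h2|h2] := leP c (- c)];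
 have [h3|h3] := lerP 0 u; rewrite ?(ger0_norm h3) ?(ltr0_norm h3);
 (split; [| |rewrite le_max; apply/orP]); try lra;
 try (by rewrite ler_norml; apply/andP; split; lra);
 try (by first [left; rewrite ler_norml; apply/andP; split; lra
               |right; rewrite ler_norml; apply/andP; split; lra]).
Qed.

(* Rows meet only inside the classes of the equivalence relation generated by
   sharing the support of a row. The classes are countable, so each of them
   carries an order of type omega; every row is then kept, in that order, up to
   total mass C. The loss at y is controlled by the finite sum over the
   predecessors of y. *)
Lemma truncate_rows (C : R) : 0 <= C ->
  (forall s e, uniq s -> 0 < e ->
     finite_set [set i | C + e <= \sum_(y <- s) `|r i y|]) ->
  exists r' : I -> J -> R,
    (forall i s, uniq s -> \sum_(y <- s) `|r' i y| <= C) /\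
    (forall y e, 0 < e -> finite_set [set i | e <= `|r i y - r' i y|]).
Proof.
move=> C0 fin.
(* The enumeration is attached to the set, so that all members of one class use the same order;
   uncountable sets get a dummy. *)
have enum A : exists f : J -> nat, countable A -> {in A &, injective f}.
  have [cA|ncA] := pselect (countable A); last by exists (fun=> 0%N).
  by have /countable_injP [f fi] := cA; exists f.
have {enum}[m m_inj] := choice enum.
pose pred y := [set z | comp y z /\ (m (comp y) z < m (comp y) y)%N].
have finpred y : finite_set (pred y).
  have inj : {in pred y &, injective (m (comp y))}.
    move=> a b /set_mem [ya _] /set_mem [yb _].
    by apply: (m_inj _ (countable_comp y)); exact: mem_set.
  rewrite -(eq_finite_set (inj_card_eq inj)).
  apply: sub_finite_set (finite_II (m (comp y) y)) => _ [z [_ zy] <-]; exact: zy.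
have predseq y : exists F, uniq F /\ forall z, (z \in F) <-> pred y z.
  have /finite_seqP [s sE] := finpred y; exists (undup s); split; first exact: undup_uniq.
  by move=> z; rewrite mem_undup sE.
have {predseq}[F FP] := choice predseq.
pose t i y := \sum_(z <- F y) `|r i z|.
(* [t i y] is the untruncated mass of row [i] before [y], so the cap is what is left of the budget
   [C]. *)
pose r' i y := clip (Num.max 0 (C - t i y)) (r i y).
have cap0 i y : 0 <= Num.max 0 (C - t i y) by rewrite le_max lexx.
exists r'; split=> [i s us|y e e0].
  rewrite (bigID (fun y => r' i y != 0)) /= [X in _ + X]big1 ?addr0; last first.
    by move=> y; rewrite negbK => /eqP ->; rewrite normr0.
  rewrite -big_filter; set s' := seq.filter _ _.
  have us' : uniq s' by rewrite filter_uniq.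
  have r'0 y : y \in s' -> r' i y != 0 by rewrite mem_filter => /andP[].
  have r0 y : y \in s' -> r i y != 0.
    move=> /r'0; apply: contra_neq => r0; have [+ _ _] := clipP (r i y) (cap0 i y).
    by rewrite -/(r' i y) r0 normr0 normr_le0 => /eqP.
  have [->|s'0] := eqVneq s' [::]; first by rewrite big_nil.
  (* The constant weight just picks some element; its class contains all of [s']. Next, [y] is the
     last element of [s'] in the order of that class: the others precede it and have mass at most
     [t i y], while the nonzero entry at [y] is at most [C - t i y]. *)
  have [y0 y0s _] := seq_argmax (fun=> 0%N) s'0.
  have [y ys ymax] := seq_argmax (m (comp y0)) s'0.
  have compE z : z \in s' -> comp z = comp y0.
    move=> zs; apply: comp_eq; apply: (comp_step (i := i) (comp_refl y0)); exact: r0.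
  rewrite (big_rem y) //=.
  have le_t : \sum_(z <- rem y s') `|r' i z| <= t i y.
    apply: (@le_trans _ _ (\sum_(z <- rem y s') `|r i z|)).
      by apply: ler_sum => z _; have [] := clipP (r i z) (cap0 i z).
    apply: ler_sum_uniq_sub => //; first exact: rem_uniq.
    move=> z; rewrite mem_rem_uniq // inE => /andP[zy zs]; apply/(FP y).2.
    split; first by rewrite compE // -(compE z zs); exact: comp_refl.
    rewrite compE // ltn_neqAle ymax // andbT; apply: contra_neq zy => mE.
    have cc := countable_comp y0.
    apply: (m_inj _ cc) mE; apply: mem_set; [rewrite -(compE z zs)|rewrite -(compE y ys)]; exact: comp_refl.
  have [_ cy _] := clipP (r i y) (cap0 i y).
  have : 0 < `|r' i y| by rewrite normr_gt0 r'0.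
  move=> /lt_le_trans /(_ cy); rewrite lt_max ltxx /= => Ct.
  move: cy; rewrite -/(r' i y) max_r ?(ltW Ct) // => cy.
  by apply: le_trans (lerD cy le_t) _; rewrite subrK.
have yF : y \notin F y by apply/negP => /(FP y).2 [_]; rewrite ltnn.
have uyF : uniq (y :: F y) by rewrite /= yF (FP y).1.
(* A loss of at least [e] at [y] forces mass at least [C + e] on the finite list [y :: F y]. *)
apply: sub_finite_set (fin _ e uyF e0) => i /= le_e; rewrite big_cons -/(t i y).
have [_ _ le3] := clipP (r i y) (cap0 i y); move: (le_trans le_e le3).
rewrite le_max leNgt e0 /= => le4.
have : C - t i y <= Num.max 0 (C - t i y) by rewrite le_max lexx orbT.
by move=> le5; lra.
Qed.

End Selection.

(** * Limits over finite lists along an ultrafilter *)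

Section GeneralizedLimit.
Set Implicit Arguments.
Unset Strict Implicit.
Context {R : realType} {J : eqType}.

(** The lists containing a given list generate a filter; bounded families converge along an
    ultrafilter refining it because segments are compact. *)
Lemma generalized_limit : exists Lim : (seq J -> R) -> R,
  (forall (a : R) (u v : seq J -> R) (Bu Bv : R), (forall s, `|u s| <= Bu) -> (forall s, `|v s| <= Bv) ->
     Lim (fun s => a * u s + v s) = a * Lim u + Lim v) /\
  (forall (u : seq J -> R) (B c e : R) (s0 : seq J), (forall s, `|u s| <= B) ->
     (forall s, {subset s0 <= s} -> `|u s - c| <= e) -> `|Lim u - c| <= e).
Proof.
pose F := filter_from [set: seq J] (fun s0 => [set s : seq J | {subset s0 <= s}]).
have FF : ProperFilter F.
  apply: filter_from_proper; last by move=> s _; exists s => x.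
  apply: filter_from_filter; first by exists [::].
  move=> s s' _ _; exists (s ++ s') => // t st; split=> x xs; apply: st; rewrite mem_cat xs ?orbT //.
have [U [UU FU]] := ultraFilterLemma FF.
have ex u : exists l : R, forall B, (forall s, `|u s| <= B) ->
    forall e, 0 < e -> U [set s | `|u s - l| < e].
  have [[B uB]|nB] := pselect (exists B, forall s, `|u s| <= B); last first.
    (* Unbounded families get the dummy value 0. *)
    by exists 0 => B uB; case: nB; exists B.
  have UB : (u @ U) `[- B, B]%classic.
    suff : U (u @^-1` `[- B, B]%classic) by [].
    by apply: filterE => s /=; rewrite in_itv /= -ler_norml.
  have [l [_ lc]] := segment_compact (fmap_proper_filter u _) UB.
  exists l => _ _ e e0.
  have [//|UC] := in_ultra_setVsetC [set s | `|u s - l| < e] UU.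
  have [|x []] := lc (~` ball l e) (ball l e) _ (nbhsx_ballx _ _ e0); last by [].
  suff : U (u @^-1` (~` ball l e)) by [].
  by apply: filterS UC => s us; rewrite /ball /= distrC.
have [Lim LimP] := choice ex; exists Lim.
have uniqL u B c e : (forall s, `|u s| <= B) ->
    U [set s | `|u s - c| <= e] -> `|Lim u - c| <= e.
  move=> uB Uc; apply/ler_addgt0Pr => eta eta0.
  have [s [/= h1 h2]] := filter_ex (filterI (LimP u B uB eta eta0) Uc).
  have := ler_distD (u s) (Lim u) c; rewrite (distrC (Lim u) (u s)); lra.
split=> [a u v Bu Bv uB vB|u B c e s0 uB us]; last first.
  apply: (uniqL u B) => //; apply: FU; exists s0 => // s; exact: us.
apply/eqP; rewrite -subr_eq0 -normr_le0; apply/ler_addgt0Pr => e e0; rewrite add0r.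
have a0 : 0 < `|a| + 1 by rewrite ltr_wpDl.
have e1 : 0 < e / (`|a| + 1) / 2 by rewrite !divr_gt0.
have e2 : 0 < e / 2 by rewrite divr_gt0.
apply: (uniqL _ (`|a| * Bu + Bv)).
  by move=> s; rewrite (le_trans (ler_normD _ _)) // normrM lerD // ler_wpM2l.
apply: filterS (filterI (LimP u Bu uB _ e1) (LimP v Bv vB _ e2)) => s [/= h1 h2].
have -> : a * u s + v s - (a * Lim u + Lim v) = a * (u s - Lim u) + (v s - Lim v) by ring.
rewrite (le_trans (ler_normD _ _)) // normrM [leRHS](_ : e = e / 2 + e / 2); last by lra.
apply: lerD; last exact: ltW.
apply: (@le_trans _ _ ((`|a| + 1) * (e / (`|a| + 1) / 2))).
  by apply: ler_pM => //; [rewrite lerDl|exact: ltW].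
by rewrite le_eqVlt; apply/orP; left; apply/eqP; field; rewrite gt_eqF.
Qed.

End GeneralizedLimit.

(** * Stability properties of c_0 families *)

Section VanishingFamilies.
Set Implicit Arguments.
Unset Strict Implicit.
Context {R : realType} {I : Type}.
Implicit Types (u v : I -> R) (c : R).

Lemma in_c0D u v : in_c0 u -> in_c0 v -> in_c0 (fun i => u i + v i).
Proof.
move=> u0 v0 e e0; have e2 : 0 < e / 2 by rewrite divr_gt0.
have fin : finite_set ([set i | e / 2 <= `|u i|] `|` [set i | e / 2 <= `|v i|]).
  by rewrite finite_setU; split; [exact: u0|exact: v0].
apply: sub_finite_set fin => i /= euv.
have [eu|ue] := leP (e / 2) `|u i|; [by left|right => /=].
have := ler_normD (u i) (v i); lra.
Qed.

Lemma in_c0Z c u : in_c0 u -> in_c0 (fun i => c * u i).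
Proof.
move=> u0 e e0; have c1 : 0 < `|c| + 1 by rewrite ltr_wpDl.
have e1 : 0 < e / (`|c| + 1) by rewrite divr_gt0.
apply: sub_finite_set (u0 _ e1) => i /=; rewrite normrM => ecu.
rewrite ler_pdivrMr // mulrC; apply: le_trans ecu _.
by rewrite ler_wpM2r // lerDl.
Qed.

Lemma in_c0_norm u : in_c0 u -> in_c0 (fun i => `|u i|).
Proof. by move=> u0 e e0; apply: sub_finite_set (u0 _ e0) => i /=; rewrite normr_id. Qed.

Lemma in_c0_sum (J : eqType) (s : seq J) (u : J -> I -> R) :
  (forall j, j \in s -> in_c0 (u j)) -> in_c0 (fun i => \sum_(j <- s) u j i).
Proof.
elim: s => [|j s IH] us.
  move=> e e0; rewrite (_ : [set i | _] = set0) ?finite_set0 //.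
  by rewrite -subset0 => i /=; rewrite big_nil normr0 leNgt e0.
under eq_fun do rewrite big_cons.
apply: in_c0D; first by apply: us; rewrite mem_head.
by apply: IH => z zs; apply: us; rewrite inE zs orbT.
Qed.

End VanishingFamilies.

(** * Interpolation on finitely many nodes of a linear order *)

Section Interpolation.
Set Implicit Arguments.
Unset Strict Implicit.
Context {R : realType} {d : Order.disp_t} {X : orderType d}.
Variable k : X -> X -> X -> R.
Hypothesis k01 : forall u v t, (u < v)%O -> 0 <= k u v t <= 1.
Hypothesis k0 : forall u v t, (u < v)%O -> (t <= u)%O -> k u v t = 0.
Hypothesis k1 : forall u v t, (u < v)%O -> (v <= t)%O -> k u v t = 1.
Implicit Types (w : X -> R) (s : seq X) (t y : X) (c r e : R).

(* The functions c - next_step y s and the further differences of consecutive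
   steps form a partition of unity when c = 1 on [y, +oo[; [interp w 1 s] is the
   corresponding combination of the values of w on the sorted list s. *)
Definition next_step y s t : R := if s is z :: _ then k y z t else 0.

Fixpoint interp w c s t : R :=
  if s is y :: s' then
    w y * (c - next_step y s' t) + interp w (next_step y s' t) s' t
  else 0.

Lemma interp_left w y s t : path <%O y s -> (t <= y)%O -> interp w 0 s t = 0.
Proof.
elim: s y => // z s IH y /= /andP[yz zs] ty.
have tz : (t <= z)%O by rewrite (le_trans ty) ?ltW.
have -> : next_step z s t = 0.
  by case: s {IH} zs => //= z' s /andP[zz' _]; exact: k0.
by rewrite subrr mulr0 add0r (IH z).
Qed.

(** The weights of the values of [w] are nonnegative, add up to [c], and vanish except at the nodes
    next to [t]. A general [c] is needed for the induction, as the tail carries the value of the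
    next step. The two side conditions on [c] ensure that no weight is lost at the end of the list
    and that the weight of the head is nonnegative. *)
Lemma interp_near w s t r e c : sorted <%O s -> 0 <= c <= 1 ->
  (s = [::] -> c = 0) -> (forall y s', s = y :: s' -> (y <= t)%O -> c = 1) ->
  (forall y, y \in s -> (forall p, p \in s -> (p <= t)%O -> (p <= y)%O) ->
     (forall q, q \in s -> (t <= q)%O -> (y <= q)%O) -> `|w y - r| <= e) ->
  `|interp w c s t - c * r| <= c * e.
Proof.
elim: s c => [|y s IH] c.
  by move=> _ _ /(_ erefl) -> _ _; rewrite /= !mul0r subrr normr0.
move=> ss /andP[c0 c1] _ /(_ y s erefl) yc near /=.
have ys z : z \in s -> (y < z)%O.
  by move: ss => /= /(order_path_min lt_trans) /allP; apply.
set n := next_step y s t.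
have n01 : 0 <= n <= 1.
  rewrite /n; case: (s) ys => [|z s'] ys /=; first by rewrite lexx ler01.
  by apply: k01; apply: ys; rewrite mem_head.
have ty_n : (t <= y)%O -> n = 0.
  rewrite /n; case: (s) ys => [|z s'] //= ys ty; apply: k0 => //.
  by apply: ys; rewrite mem_head.
have nc : n <= c.
  have [/yc ->|/ltW /ty_n -> //] := leP y t; by case/andP: n01.
have term1 : `|w y * (c - n) - (c - n) * r| <= (c - n) * e.
  have [->|cn] := eqVneq c n; first by rewrite subrr mulr0 !mul0r subrr normr0.
  rewrite mulrC -mulrBr normrM ger0_norm ?subr_ge0 // ler_wpM2l ?subr_ge0 //.
  apply: near; first exact: mem_head.
    move=> p; rewrite inE => /predU1P[->//|ps pt]; exfalso; move/eqP: cn; apply.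
    have n1 : n = 1.
      rewrite /n; case: (s) ps ys ss => //= z s' ps ys /andP[yz zs]; apply: k1 => //.
      apply: le_trans pt; move: ps; rewrite inE => /predU1P[->//|ps].
      by move: zs => /(order_path_min lt_trans) /allP /(_ _ ps) /ltW.
    by apply/eqP; move: nc; rewrite n1 eq_le c1 => ->.
  by move=> q; rewrite inE => /predU1P[->//|/ys /ltW].
have term2 : `|interp w n s t - n * r| <= n * e.
  have [ty|yt] := leP t y.
    by rewrite ty_n // (@interp_left _ y) // !mul0r subrr normr0.
  apply: IH => //.
  - exact: path_sorted ss.
  - by rewrite /n => ->.
  - move=> z s' sE zt; rewrite /n sE; apply: k1 => //.
    by apply: ys; rewrite sE mem_head.
  - move=> z zs pz qz; apply: near; first by rewrite inE zs orbT.
      by move=> p; rewrite inE => /predU1P[-> _|]; [exact/ltW/ys|exact: pz].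
    move=> q; rewrite inE => /predU1P[-> ty|]; last exact: qz.
    by move: yt; rewrite ltNge ty.
rewrite [X in `|X|](_ : _ = (w y * (c - n) - (c - n) * r) + (interp w n s t - n * r)); last by ring.
apply: le_trans (ler_normD _ _) _; apply: le_trans (lerD term1 term2) _.
by rewrite -mulrDl subrK.
Qed.

Lemma interp1_near w s t r e : sorted <%O s -> s != [::] ->
  (forall y, y \in s -> (forall p, p \in s -> (p <= t)%O -> (p <= y)%O) ->
     (forall q, q \in s -> (t <= q)%O -> (y <= q)%O) -> `|w y - r| <= e) ->
  `|interp w 1 s t - r| <= e.
Proof.
move=> ss s0 near; rewrite -[r in leLHS]mul1r -[e]mul1r.
by apply: interp_near => //; [rewrite ler01 lexx|move=> sE; rewrite sE in s0].
Qed.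

Lemma interp_linear a w v c s t :
  interp (fun y => a * w y + v y) c s t = a * interp w c s t + interp v c s t.
Proof.
elim: s c => [|y s IH] c /=; first by rewrite mulr0 addr0.
by rewrite IH; ring.
Qed.

End Interpolation.

Lemma continuous_interp (R : realType) (d : Order.disp_t)
    (X : orderTopologicalType d) (k : X -> X -> X -> R) (w : X -> R) (s : seq X)
    (c : X -> R) :
  (forall u v, continuous (k u v)) -> continuous c ->
  continuous (fun t => interp k w (c t) s t).
Proof.
move=> ck; elim: s c => [|y s IH] c cc /=; first exact: continuous_cst_fun.
have cn : continuous (next_step k y s).
  by case: (s) => [|z s']; [exact: continuous_cst_fun|exact: ck].
apply: continuous_scaleD; last exact: IH.
by move=> t; apply: cvgB; [exact: cc|exact: cn].
Qed.

(** * The fibres of [phi] and their endpoints *)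

Section Fibres.
Set Implicit Arguments.
Unset Strict Implicit.
Context {R : realType} {dK dL : Order.disp_t}.
Context {K : orderTopologicalType dK} {L : orderTopologicalType dL}.
Hypotheses (hK : compact [set: K]) (hL : compact [set: L]).
Variable phi : K -> L.
Hypotheses (phi_cont : continuous phi)
  (phi_incr : {homo phi : x y / (x <= y)%O})
  (phi_surj : forall y : L, exists x, phi x = y).

Lemma fibre_endpoints : exists ab : L -> K * K, forall y,
  [/\ phi (ab y).1 = y, phi (ab y).2 = y &
      forall x, phi x = y -> ((ab y).1 <= x)%O /\ (x <= (ab y).2)%O].
Proof.
suff /choice [ab abP] : forall y, exists p : K * K,
    [/\ phi p.1 = y, phi p.2 = y & forall x, phi x = y -> (p.1 <= x)%O /\ (x <= p.2)%O].
  by exists ab.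
move=> y.
pose A := phi @^-1` `[y, y]%classic.
have AE x : A x <-> phi x = y.
  rewrite /A /= in_itv /=; split; last by move=> ->; rewrite lexx.
  by move=> /andP[h1 h2]; apply/eqP; rewrite eq_le h1 h2.
have cA : closed A by apply: closed_comp; [move=> x _; exact: phi_cont|exact: itv_closed].
have A0 : A !=set0 by have [x xy] := phi_surj y; exists x; exact/AE.
have [a Aa amin] := closed_has_min hK cA A0.
have [b Ab bmax] := closed_has_max hK cA A0.
exists (a, b); split => /=; [exact/AE|exact/AE|].
by move=> x /AE Ax; split; [exact: amin|exact: bmax].
Qed.

Variable ab : L -> K * K.
Hypothesis abP : forall y,
  [/\ phi (ab y).1 = y, phi (ab y).2 = y &
      forall x, phi x = y -> ((ab y).1 <= x)%O /\ (x <= (ab y).2)%O].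
Let a y := (ab y).1.
Let b y := (ab y).2.

Lemma phi_lt x x' : (phi x < phi x')%O -> (x < x')%O.
Proof. by rewrite !ltNge; apply: contra => /phi_incr. Qed.

Lemma phi_leftE y : phi (a y) = y. Proof. by have [] := abP y. Qed.
Lemma phi_rightE y : phi (b y) = y. Proof. by have [] := abP y. Qed.

Lemma left_le_right y : (a y <= b y)%O.
Proof. by have [_ bE /(_ _ bE)[]] := abP y. Qed.

Lemma lt_left x y : (phi x < y)%O -> (x < a y)%O.
Proof. by move=> xy; apply: phi_lt; rewrite phi_leftE. Qed.

Lemma gt_right x y : (y < phi x)%O -> (b y < x)%O.
Proof. by move=> xy; apply: phi_lt; rewrite phi_rightE. Qed.

Lemma right_lt_left y z : (y < z)%O -> (b y < a z)%O.
Proof. by move=> yz; apply: phi_lt; rewrite phi_leftE phi_rightE. Qed.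

(** * Step functions on [L] and [K], and approximation by them *)

Variables (k : L -> L -> L -> R) (ind : L -> K -> R).
Hypothesis kC : forall u v, continuous (k u v).
Hypothesis k01 : forall u v t, (u < v)%O -> 0 <= k u v t <= 1.
Hypothesis k0 : forall u v t, (u < v)%O -> (t <= u)%O -> k u v t = 0.
Hypothesis k1 : forall u v t, (u < v)%O -> (v <= t)%O -> k u v t = 1.
Hypothesis indC : forall y, continuous (ind y).
Hypothesis ind01 : forall y x, (a y < b y)%O -> 0 <= ind y x <= 1.
Hypothesis ind0 : forall y x, (a y < b y)%O -> (x <= a y)%O -> ind y x = 0.
Hypothesis ind1 : forall y x, (a y < b y)%O -> (b y <= x)%O -> ind y x = 1.

(** With [ind_left] this shows that, among all fibres, [ind y] jumps only across the one over [y],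
    and by 1. *)
Lemma ind_right y z : (a y < b y)%O -> ind y (b z) = (y <= z)%O%:R.
Proof.
move=> yQ; have [yz|zy] := leP y z.
  apply: ind1 => //; move: yz; rewrite le_eqVlt => /predU1P[->//|/right_lt_left bz].
  exact: le_trans (ltW bz) (left_le_right z).
by apply: ind0 => //; exact/ltW/right_lt_left.
Qed.

Lemma ind_left y z : (a y < b y)%O -> ind y (a z) = (y < z)%O%:R.
Proof.
move=> yQ; have [yz|zy] := ltP y z.
  by apply: ind1 => //; exact/ltW/right_lt_left.
apply: ind0 => //; move: zy; rewrite le_eqVlt => /predU1P[->//|/right_lt_left bz].
exact: le_trans (left_le_right z) (ltW bz).
Qed.

(* The steps interlace: 1 >= e_y1 >= k y1 y2 >= e_y2 >= ..., so the distances
   between consecutive ones telescope. *)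
Lemma interlacing_sum (s : seq L) (c : L -> R) :
  sorted <%O s -> (forall y, y \in s -> (a y < b y)%O) ->
  continuous c -> (forall t, 0 <= c t <= 1) ->
  (forall y s' t, s = y :: s' -> (y <= t)%O -> c t = 1) ->
  exists G : L -> L -> R, (forall y, continuous (G y)) /\
    forall x, \sum_(y <- s) `|2 * ind y x - G y (phi x)| <= c (phi x).
Proof.
elim: s c => [|y s IH] c ss sQ cc c01 cy.
  exists (fun _ _ => 0); split; first by move=> _; exact: continuous_cst_fun.
  by move=> x; rewrite big_nil; have /andP[] := c01 (phi x).
have ys z : z \in s -> (y < z)%O.
  by move: ss => /= /(order_path_min lt_trans) /allP; apply.
pose n := next_step k y s.
have nC : continuous n.
  by rewrite /n; case: (s) => [|z s'] /=; [exact: continuous_cst_fun|exact: kC].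
have n01 t : 0 <= n t <= 1.
  rewrite /n; case: (s) ys => [|z s'] ys /=; first by rewrite lexx ler01.
  by apply: k01; apply: ys; rewrite mem_head.
have n0 t : (t <= y)%O -> n t = 0.
  by rewrite /n; case: (s) ys => [|z s'] //= ys ty; apply: k0 => //; apply: ys; rewrite mem_head.
have [|||||G [GC GP]] := IH n.
- exact: path_sorted ss.
- by move=> z zs; apply: sQ; rewrite inE zs orbT.
- exact: nC.
- exact: n01.
- move=> z s' t sE zt; rewrite /n sE /=; apply: k1 => //.
  by apply: ys; rewrite sE mem_head.
(* From [n <= ind y <= c] it follows that [2 * ind y] is within [c - n] of [c + n]; the remaining
   terms sum to at most [n]. *)
exists (fun z => if z == y then (fun t => c t + n t) else G z); split.
  by move=> z; case: ifP => // _ t; apply: cvgD; [exact: cc|exact: nC].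
move=> x; rewrite big_cons eqxx big_seq.
under eq_bigr => z zs do rewrite gt_eqF ?ys //.
rewrite -big_seq -lerBrDr; apply: le_trans (_ : c (phi x) - n (phi x) <= _); last first.
  by rewrite lerB.
have yQ : (a y < b y)%O by apply: sQ; rewrite mem_head.
have /andP[i0 i1] := ind01 x yQ.
have /andP[c0 c1] := c01 (phi x); have /andP[m0 m1] := n01 (phi x).
have ci : ind y x <= c (phi x).
  have [yx|/lt_left xy] := leP y (phi x); first by rewrite (cy y s).
  by rewrite ind0 // ltW.
have ni : n (phi x) <= ind y x.
  have [xy|/gt_right yx] := leP (phi x) y; first by rewrite n0.
  by rewrite ind1 // ltW.
by rewrite ler_norml; apply/andP; split; lra.
Qed.

Lemma interlacing (s : seq L) : uniq s -> (forall y, y \in s -> (a y < b y)%O) ->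
  exists G : L -> L -> R, (forall y, continuous (G y)) /\
    forall x, \sum_(y <- s) `|2 * ind y x - G y (phi x)| <= 1.
Proof.
move=> us sQ; have [||||| G [GC GP]] := @interlacing_sum (sort <=%O s) (fun=> 1).
- by rewrite lt_sorted_uniq_le sort_uniq us sort_le_sorted.
- by move=> y; rewrite mem_sort; exact: sQ.
- exact: continuous_cst_fun.
- by move=> t; rewrite ler01 lexx.
- by [].
exists G; split=> // x; apply: le_trans (GP x); rewrite le_eqVlt; apply/orP; left.
by apply/eqP/perm_big; rewrite perm_sym perm_sort.
Qed.

(** Subtracting the jumps of [f] over the finite set [D] leaves [f1] with equal values at both ends
    of each fibre over [D]. Off [D], [f1] at a fibre endpoint is within [e] of its values at the
    neighbouring nodes, so interpolating [f1] along [b] suffices. Only fibre endpoints are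
    controlled, which is all that the later norm estimate uses. *)
Lemma approximation (f : K -> R) (e : R) : continuous f -> 0 < e ->
  exists (g : L -> R) (s : seq L), [/\ continuous g,
    (forall y, y \in s -> (a y < b y)%O) &
    forall t x, x = a t \/ x = b t ->
      `|f x - (g (phi x) + \sum_(y <- s) (f (b y) - f (a y)) * ind y x)| <= e].
Proof.
move=> cf e0; have [G GP] := finite_oscillation hK cf e0.
pose D := undup (map phi G); pose s := [seq y <- D | (a y < b y)%O].
have sQ y : y \in s -> (a y < b y)%O by rewrite mem_filter => /andP[].
have us : uniq s by rewrite filter_uniq ?undup_uniq.
pose h x := \sum_(y <- s) (f (b y) - f (a y)) * ind y x.
pose f1 x := f x - h x.
have f1D y : y \in D -> f1 (a y) = f1 (b y).
  move=> yD; apply/eqP; rewrite /f1 -subr_eq0.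
  have -> : f (a y) - h (a y) - (f (b y) - h (b y)) = (h (b y) - h (a y)) - (f (b y) - f (a y)) by ring.
  rewrite subr_eq0 /h -sumrB; apply/eqP.
  have [yQ|] := ltP (a y) (b y); last first.
    move=> ba; have abE : a y = b y by apply/eqP; rewrite eq_le left_le_right ba.
    by rewrite abE subrr big1 // => z _; rewrite subrr.
  have ys : y \in s by rewrite mem_filter yQ.
  rewrite (bigD1_seq y) //= big1_seq ?addr0.
    by rewrite ind_right // ind_left // lexx ltxx mulr1 mulr0 subr0.
  move=> z /andP[zy zs]; rewrite ind_right ?ind_left ?sQ //.
  by rewrite le_eqVlt (negPf zy) /= subrr.
exists (interp k (fun y => f1 (b y)) 1 (sort <=%O D)), s; split=> //.
  by apply: continuous_interp => //; exact: continuous_cst_fun.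
move=> t x xt; have phix : phi x = t by case: xt => ->; rewrite ?phi_leftE ?phi_rightE.
rewrite opprD addrA addrAC -/(h x) -/(f1 x) phix distrC.
have [p [q [pG qG px xq pq]]] := GP x.
have pD : phi p \in D by rewrite mem_undup map_f.
have qD : phi q \in D by rewrite mem_undup map_f.
apply: interp1_near => //.
- by rewrite lt_sorted_uniq_le sort_uniq undup_uniq sort_le_sorted.
- by apply/eqP => sE; have := pD; rewrite -(mem_sort <=%O) sE.
move=> y; rewrite mem_sort => yD lowy highy.
have [tD|tD] := boolP (t \in D).
  have yt : y = t.
    apply/eqP; rewrite eq_le highy ?mem_sort ?lexx //.
    by rewrite lowy ?mem_sort ?lexx.
  rewrite yt; case: xt => ->; last by rewrite subrr normr0 ltW.
  by rewrite f1D // subrr normr0 ltW.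
have pt : (phi p < t)%O.
  rewrite lt_neqAle -{2}phix phi_incr // andbT; apply: contraNneq tD => <-; exact: pD.
have tq : (t < phi q)%O.
  rewrite lt_neqAle -{2}phix phi_incr // andbT; apply: contraNneq tD => ->; exact: qD.
have py : (phi p <= y)%O by apply: lowy; rewrite ?mem_sort // ltW.
have yq : (y <= phi q)%O by apply: highy; rewrite ?mem_sort // ltW.
have hx : h x = \sum_(z <- s) (f (b z) - f (a z)) * (z <= t)%O%:R.
  apply: eq_big_seq => z zs; case: xt => ->; last by rewrite ind_right // sQ.
  rewrite ind_left ?sQ // le_eqVlt; case: eqVneq => //= zt.
  by move: zs; rewrite zt mem_filter (negPf tD) andbF.
(* No node separates [y] from [t], so the jump parts cancel and the oscillation of [f] on [p, q]
   decides. For [y <= t] the point [b y] lies in [p, q]; for [t < y] it may lie beyond [q], and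
   [a y] is used instead. *)
have [yt|ty] := leP y t.
  have -> : f1 (b y) - f1 x = f (b y) - f x.
    rewrite /f1 hx /h.
    under eq_big_seq => z zs.
      rewrite ind_right ?sQ //.
      have -> : (z <= y)%O = (z <= t)%O.
        apply/idP/idP => [zy|zt]; first exact: le_trans yt.
        apply: lowy; rewrite ?mem_sort //.
        by move: zs; rewrite mem_filter => /andP[].
      over.
    ring.
  apply: pq; last first.
    apply: ltW; apply: phi_lt; rewrite phi_rightE; exact: le_lt_trans yt tq.
  have [_ _ /(_ p)] := abP y; rewrite /b.
  move: py; rewrite le_eqVlt => /predU1P[pyE /(_ pyE)[]//|/lt_left pay _].
  exact: le_trans (ltW pay) (left_le_right y).
rewrite -f1D //.
have -> : f1 (a y) - f1 x = f (a y) - f x.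
  rewrite /f1 hx /h.
  under eq_big_seq => z zs.
    rewrite ind_left ?sQ //.
    have -> : (z < y)%O = (z <= t)%O.
      apply/idP/idP => [zy|zt]; last exact: le_lt_trans zt ty.
      rewrite leNgt; apply/negP => tz; move: zy; rewrite ltNge => /negP; apply.
      apply: highy; rewrite ?mem_sort ?ltW //.
      by move: zs; rewrite mem_filter => /andP[].
    over.
  ring.
apply: pq.
  apply: ltW; apply: phi_lt; rewrite phi_leftE; exact: lt_trans pt ty.
have [_ _ /(_ q)] := abP y; rewrite /a.
move: yq; rewrite le_eqVlt => /predU1P[qyE /(_ (esym qyE))[]//|/gt_right bq _].
exact: le_trans (left_le_right y) (ltW bq).
Qed.

(** * Interpolation along the right endpoints of the fibres *)

Variable Lim : (seq L -> R) -> R.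
Hypothesis Lim_linear : forall (c : R) (u v : seq L -> R) (Bu Bv : R),
  (forall s, `|u s| <= Bu) -> (forall s, `|v s| <= Bv) ->
  Lim (fun s => c * u s + v s) = c * Lim u + Lim v.
Hypothesis Lim_near : forall (u : seq L -> R) (B c e : R) (s0 : seq L),
  (forall s, `|u s| <= B) ->
  (forall s, {subset s0 <= s} -> `|u s - c| <= e) -> `|Lim u - c| <= e.

Lemma Lim_eventually (u : seq L -> R) (B c : R) (s0 : seq L) :
  (forall s, `|u s| <= B) -> (forall s, {subset s0 <= s} -> u s = c) -> Lim u = c.
Proof.
move=> uB uc; apply/eqP; rewrite -subr_eq0 -normr_le0.
by apply: (Lim_near (s0 := s0) uB) => s /uc ->; rewrite subrr normr0.
Qed.

Lemma Lim_le (u : seq L -> R) (B : R) : (forall s, `|u s| <= B) -> `|Lim u| <= B.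
Proof.
move=> uB; rewrite -[Lim u]subr0.
by apply: (Lim_near (s0 := [::]) uB) => s _; rewrite subr0.
Qed.

(** A continuous substitute for the function sending [y] to [f (b y)], which need not be continuous
    on [L]. *)
Definition sweep (s : seq L) (f : K -> R) : L -> R :=
  interp k (fun y => f (b y)) 1 (sort <=%O (undup s)).

Lemma continuous_sweep s f : continuous (sweep s f).
Proof. by apply: continuous_interp => //; exact: continuous_cst_fun. Qed.

Lemma sweep_near s (f : K -> R) (t : L) (r e : R) (p0 : L) : p0 \in s ->
  (forall y, y \in s -> (forall p, p \in s -> (p <= t)%O -> (p <= y)%O) ->
     (forall q, q \in s -> (t <= q)%O -> (y <= q)%O) -> `|f (b y) - r| <= e) ->
  `|sweep s f t - r| <= e.
Proof.
move=> p0s near; apply: interp1_near => //.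
- by rewrite lt_sorted_uniq_le sort_uniq undup_uniq sort_le_sorted.
- by apply/eqP => sE; move: p0s; rewrite -mem_undup -(mem_sort <=%O) sE.
move=> y; rewrite mem_sort mem_undup => ys lowy highy; apply: near => // p ps.
  by apply: lowy; rewrite mem_sort mem_undup.
by apply: highy; rewrite mem_sort mem_undup.
Qed.

Lemma sweep_le s (f : K -> R) (c : R) t : 0 <= c -> (forall y, `|f (b y)| <= c) ->
  `|sweep s f t| <= c.
Proof.
case: s => [|p0 s] c0 fc; first by rewrite /sweep /= normr0.
rewrite -[sweep _ _ _]subr0; apply: (@sweep_near _ _ _ _ _ p0); first exact: mem_head.
by move=> y _ _ _; rewrite subr0.
Qed.

Lemma sweep_ind_ge s y t : (a y < b y)%O -> y \in s -> (y <= t)%O ->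
  sweep s (ind y) t = 1.
Proof.
move=> yQ ys yt; apply/eqP; rewrite -subr_eq0 -normr_le0.
apply: (sweep_near ys) => z _ /(_ y ys yt) yz _.
by rewrite ind_right // yz subrr normr0.
Qed.

Lemma sweep_ind_le s y z t : (a y < b y)%O -> z \in s -> (z < y)%O -> (t <= z)%O ->
  sweep s (ind y) t = 0.
Proof.
move=> yQ zs zy tz; apply/eqP; rewrite -[sweep _ _ _]subr0 -normr_le0.
apply: (sweep_near zs) => x _ _ /(_ z zs tz) xz.
by rewrite ind_right // (lt_geF (le_lt_trans xz zy)) subr0 normr0.
Qed.

Lemma sweep_ind01 s y t : (a y < b y)%O -> 0 <= sweep s (ind y) t <= 1.
Proof.
move=> yQ; case: s => [|p0 s]; first by rewrite /sweep /= lexx ler01.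
suff : `|sweep (p0 :: s) (ind y) t - 1 / 2| <= 1 / 2.
  by rewrite ler_norml => /andP[? ?]; apply/andP; split; lra.
apply: (@sweep_near _ _ _ _ _ p0); first exact: mem_head.
by move=> z _ _ _; rewrite ind_right //; case: (y <= z)%O => /=; rewrite ler_norml; apply/andP; split; lra.
Qed.

(** * Extending functionals from C(L) to C(K) with the same bound *)

Section Lift.
Variables (nu : (L -> R) -> R) (m : R).
Hypothesis nuP : bounded_functional nu m.

Definition lift (f : K -> R) : R := Lim (fun s => nu (sweep s f)).

Lemma nu_sweep_le f (c : R) s : 0 <= c -> (forall y, `|f (b y)| <= c) ->
  `|nu (sweep s f)| <= m * c.
Proof.
move=> c0 fc; have [_ _ bd] := nuP.
by apply: bd => //; [exact: continuous_sweep|move=> t; exact: sweep_le].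
Qed.

Lemma lift_le f (c : R) : 0 <= c -> (forall y, `|f (b y)| <= c) -> `|lift f| <= m * c.
Proof. by move=> c0 fc; apply: Lim_le => s; exact: nu_sweep_le. Qed.

Lemma lift_functional : bounded_functional lift m.
Proof.
have [m0 lin _] := nuP.
have bnd (f : K -> R) : continuous f -> exists B, forall s, `|nu (sweep s f)| <= B.
  move=> cf; have [B fB] := compact_line_bounded hK cf.
  exists (m * `|B|) => s; apply: nu_sweep_le => // y.
  exact: le_trans (fB _) (ler_norm _).
split=> //; last by move=> f c _ c0 fc; exact: lift_le.
move=> c f g cf cg; have [Bf fB] := bnd _ cf; have [Bg gB] := bnd _ cg.
rewrite /lift -(Lim_linear _ fB gB); congr Lim; apply/funext => s.
rewrite -lin; [|exact: continuous_sweep|exact: continuous_sweep].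
by congr nu; apply/funext => t; rewrite /sweep -interp_linear.
Qed.

(** Once [s] contains a list of small oscillation for [g], the sweep of [g \o phi] is uniformly
    close to [g]. *)
Lemma lift_comp (g : L -> R) : continuous g -> lift (g \o phi) = nu g.
Proof.
move=> cg; have [m0 _ bd] := nuP.
apply/eqP; rewrite -subr_eq0 -normr_le0; apply/ler_addgt0Pr => e e0; rewrite add0r.
have m1 : 0 < m + 1 by rewrite ltr_wpDl.
have e1 : 0 < e / (m + 1) by rewrite divr_gt0.
have [s0 s0P] := finite_oscillation hL cg e1.
have [B gB] := compact_line_bounded hL cg.
apply: (@Lim_near _ (m * `|B|) _ _ s0) => [s|s s0s].
  by apply: nu_sweep_le => // y; rewrite /= (le_trans (gB _)) ?ler_norm.
rewrite -(functionalB nuP) //; last exact: continuous_sweep.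
apply: (@le_trans _ _ (m * (e / (m + 1)))); last first.
  by rewrite mulrA ler_pdivrMr // mulrC ler_wpM2l ?(ltW e0) // lerDl.
apply: bd => [|| t]; last 2 first.
- exact: ltW.
- have [p [q [ps qs pt tq pq]]] := s0P t.
  apply: (sweep_near (s0s _ ps)) => y _ /(_ p (s0s _ ps) pt) py /(_ q (s0s _ qs) tq) yq.
  by rewrite /= (phi_rightE y); exact: pq.
- by move=> t; apply: cvgB; [exact: continuous_sweep|exact: cg].
Qed.

(** As soon as [s] contains [z] and [y], the sweep of [ind y] and the step [k z y] differ only
    inside ]z, y[, where [nu] has variation at most [e] by [variation_left]. *)
Lemma lift_ind_left y z0 (e : R) : (a y < b y)%O -> (z0 < y)%O -> 0 < e ->
  exists2 z1, (z1 < y)%O & forall z, (z1 <= z)%O -> (z < y)%O ->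
    `|lift (ind y) - nu (k z y)| <= e.
Proof.
move=> yQ z0y e0; have [z1 z1y z1P] := variation_left nuP z0y e0.
exists z1 => // z z1z zy.
apply: (@Lim_near _ (m * 1) _ _ [:: z; y]) => [s|s s0s].
  by apply: nu_sweep_le => // x; rewrite ind_right //; case: (y <= x)%O; rewrite ?normr1 ?normr0.
have zs : z \in s by apply: s0s; rewrite mem_head.
have ys : y \in s by apply: s0s; rewrite !inE eqxx orbT.
rewrite -(functionalB nuP) //; last exact: continuous_sweep.
apply: z1P => t.
- by apply: cvgB; [exact: continuous_sweep|exact: kC].
- have /andP[? ?] := sweep_ind01 s t yQ; have /andP[? ?] := k01 t zy.
  by rewrite ler_norml; apply/andP; split; lra.
move=> ne0; split; rewrite ltNge; apply/negP => ht; move/eqP: ne0; apply.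
  have tz := le_trans ht z1z.
  by rewrite (@sweep_ind_le s y z) // k0 // subrr.
by rewrite sweep_ind_ge // k1 // subrr.
Qed.

(** Covers the least [y], which has nothing on its left: every sweep through it is constant 1. *)
Lemma lift_ind_min y : (a y < b y)%O -> (forall z, (y <= z)%O) ->
  lift (ind y) = nu (fun=> 1).
Proof.
move=> yQ ymin; apply: (@Lim_eventually _ (m * 1) _ [:: y]) => [s|s ys].
  by apply: nu_sweep_le => // x; rewrite ind_right //; case: (y <= x)%O; rewrite ?normr1 ?normr0.
by congr nu; apply/funext => t; rewrite sweep_ind_ge // ys ?mem_head.
Qed.

End Lift.

(** * Correcting the extensions to a c_0-valued operator *)

Section Operators.
Variables (I : Type) (T : (L -> R) -> I -> R) (S : (K -> R) -> I -> R) (tau M : R).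
Hypothesis TP : forall i, bounded_functional (fun g => T g i) tau.
Hypothesis Tc0 : forall g, continuous g -> in_c0 (T g).
Hypothesis SP : forall i, bounded_functional (fun f => S f i) M.
Hypothesis Sc0 : forall f, continuous f -> in_c0 (S f).
Hypothesis ST : forall g, continuous g -> S (g \o phi) = T g.

(** This is lambda_i of the overview; the mu_i of the overview is [S _ i] here. *)
Let mu i := lift (fun g => T g i).
Let rho i y : R := if (a y < b y)%O then S (ind y) i - mu i (ind y) else 0.

(** Take [F i] as the sum of the interlacing differences [D y] with the signs of [rho i y]. It has
    norm at most 1, and since [S] and [mu] agree on each [G y \o phi], their difference at [F i] is
    twice the mass of [rho i] on [s]. *)
Let rho_sum (s : seq L) : uniq s -> exists F : I -> K -> R,
  [/\ forall i, continuous (F i), forall i x, `|F i x| <= 1,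
      forall i, 2 * \sum_(y <- s) `|rho i y| <= tau + `|S (F i) i| &
      in_c0 (fun i => S (F i) i)].
Proof.
move=> us; pose s' := [seq y <- s | (a y < b y)%O].
have sQ y : y \in s' -> (a y < b y)%O by rewrite mem_filter => /andP[].
have [G [GC GP]] := interlacing (filter_uniq _ us) sQ.
pose D y x := 2 * ind y x - G y (phi x).
have DC y : continuous (D y).
  have cG : continuous (G y \o phi).
    by move=> x; apply: continuous_comp; [exact: phi_cont|exact: GC].
  by move=> x; apply: cvgB; [apply: cvgM; [exact: cvg_cst|exact: indC]|exact: cG].
have DE y (xi : (K -> R) -> R) c : bounded_functional xi c ->
    xi (D y) = 2 * xi (ind y) - xi (G y \o phi).
  move=> xiP; rewrite /D (functionalB xiP) ?(functionalZ xiP) //.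
    by move=> x; apply: cvgM; [exact: cvg_cst|exact: indC].
  by move=> x; apply: continuous_comp; [exact: phi_cont|exact: GC].
pose F i x := \sum_(y <- s') Num.sg (rho i y) * D y x.
have sg1 (u : R) : `|Num.sg u| <= 1 by rewrite normr_sg lern1; case: (_ != _).
have FC i : continuous (F i) by exact: continuous_sumZ.
have F1 i x : `|F i x| <= 1.
  apply: le_trans (GP x); apply: le_trans (ler_norm_sum _ _ _) _.
  by apply: ler_sum => y _; rewrite normrM ler_piMl.
exists F; split=> //.
- move=> i; have muP := lift_functional (TP i).
  have -> : 2 * \sum_(y <- s) `|rho i y| = S (F i) i - mu i (F i).
    rewrite /mu (functional_sumZ (SP i)) // (functional_sumZ muP) // -sumrB.
    have -> : \sum_(y <- s) `|rho i y| = \sum_(y <- s') `|rho i y|.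
      rewrite big_filter [RHS]big_mkcond; apply: eq_bigr => y _.
      by rewrite /rho; case: ifP; rewrite ?normr0.
    rewrite mulr_sumr; apply: eq_big_seq => y /sQ yQ.
    rewrite (DE _ _ _ (SP i)) (DE _ _ _ muP) ST // (lift_comp (TP i)) //.
    rewrite normrEsg /rho yQ /mu; set g := Num.sg _; ring.
  have := functional_le1 muP (FC i) (F1 i); have := ler_norm (S (F i) i).
  by rewrite ler_norml /mu => h1 /andP[h2 h3]; lra.
(* The signs depend on [i], but this finite sum of c_0 families dominates every choice of them. *)
- have c0D : in_c0 (fun i => \sum_(y <- s') `|S (D y) i|).
    by apply: in_c0_sum => y _; apply/in_c0_norm/Sc0.
  move=> e e0; apply: sub_finite_set (c0D _ e0) => i /= eS.
  rewrite ger0_norm ?sumr_ge0 //; apply: le_trans eS _.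
  rewrite (functional_sumZ (SP i)) //; apply: le_trans (ler_norm_sum _ _ _) _.
  by apply: ler_sum => y _; rewrite normrM ler_piMl.
Qed.

Let tau0 (i : I) : 0 <= tau. Proof. by have [] := TP i. Qed.

Let rho_row_countable i : countable [set y | rho i y != 0].
Proof.
apply: countable_nonzero => e e0; apply: finite_set_countable.
apply: (@bounded_sums_finite _ _ _ ((tau + M) / 2)) => // s us.
have [F [FC F1 /(_ i) Fle _]] := rho_sum us.
have := functional_le1 (SP i) (FC i) (F1 i); lra.
Qed.

(* For a fixed y, the value mu i (ind y) is close to T (k z y) i for all z close
   enough to y on the left; how close depends on i. *)
Let rho_col_countable y : countable [set i | rho i y != 0].
Proof.
apply: countable_nonzero => e e0.
have [yQ|nyQ] := boolP (a y < b y)%O; last first.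
  have -> : [set i | e <= `|rho i y|] = set0.
    by rewrite -subset0 => i /=; rewrite /rho (negPf nyQ) normr0 leNgt e0.
  exact: countable0.
have e2 : 0 < e / 2 by rewrite divr_gt0.
have e4 : 0 < e / 4 by rewrite divr_gt0.
suff cmu : countable [set i | e / 2 <= `|mu i (ind y)|].
  apply: (@sub_countable _ _ _ (\bigcup_(c in [set: bool])
      (if c then [set i | e / 2 <= `|S (ind y) i|] else [set i | e / 2 <= `|mu i (ind y)|]))).
    apply: subset_card_le => i /=; rewrite /rho yQ => eS.
    have [h|h] := leP (e / 2) `|S (ind y) i|; [by exists true|exists false => //=].
    by have := ler_normB (S (ind y) i) (mu i (ind y)); lra.
  apply: bigcup_countable => // -[] _ //.
  by apply/finite_set_countable/Sc0.
have [[z0 z0y]|ymin] := pselect (exists z0, (z0 < y)%O); last first.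
  apply: finite_set_countable; apply: sub_finite_set (Tc0 (@continuous_cst_fun R L 1) e2) => i /=.
  rewrite /mu (lift_ind_min (TP i)) // => z; rewrite leNgt; apply/negP => zy.
  by apply: ymin; exists z.
have /choice [z1 z1P] i : exists z1, (z1 < y)%O /\ forall z, (z1 <= z)%O -> (z < y)%O ->
    `|mu i (ind y) - T (k z y) i| <= e / 4.
  by have [z1 z1y z1P] := lift_ind_left (TP i) yQ z0y e4; exists z1.
(* If [z1 j <= z1 i], the point [z1 i] is close enough to [y] for [j] as well, so [T (k (z1 i) y) j]
   is at least [e / 4] in modulus; this holds for finitely many [j]. *)
apply: (@countable_small_initial_segments _ _ _ _ z1) => i _.
have [z1y _] := z1P i.
have fin : finite_set [set j | e / 4 <= `|T (k (z1 i) y) j|] by apply: Tc0.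
apply: sub_finite_set fin => j /= [ej zji].
have [_ /(_ _ zji z1y)] := z1P j.
by have := lerB_dist (mu j (ind y)) (T (k (z1 i) y) j); lra.
Qed.

Lemma extension_le_twice : exists S' : (K -> R) -> I -> R,
  [/\ forall i, bounded_functional (fun f => S' f i) (2 * tau),
      forall f, continuous f -> in_c0 (S' f) &
      forall g, continuous g -> S' (g \o phi) = T g].
Proof.
(* An index is what yields [0 <= tau]; for empty [I], [S] itself serves. *)
have [[i0 _]|nI] := pselect (exists i : I, True); last first.
  have noI (i : I) : False by apply: nI; exists i.
  by exists S; split=> // i; case: (noI i).
have tau2 : 0 <= tau / 2 by rewrite divr_ge0 ?(tau0 i0).
have [s e us e0|rho' [rho'_sum rho'_near]] :=
    truncate_rows rho_row_countable rho_col_countable tau2.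
  have [F [_ _ Fle Fc0]] := rho_sum us.
  (* Mass at least [tau / 2 + e] on [s] makes [S (F i) i] at least [2 * e] in modulus. *)
  apply: sub_finite_set (Fc0 (2 * e) _) => [i /= le_e|]; last by rewrite mulr_gt0.
  by have := Fle i; lra.
pose jump (f : K -> R) y := f (b y) - f (a y).
pose corr i (f : K -> R) s := \sum_(y <- undup s) rho' i y * jump f y.
(* The sum over all [y] is taken as the limit of its finite partial sums. *)
pose S' f i := mu i f + Lim (corr i f).
have corr_le i (f : K -> R) c s : 0 <= c -> (forall y, `|f (a y)| <= c /\ `|f (b y)| <= c) ->
    `|corr i f s| <= tau * c.
  move=> c0 fc; apply: le_trans (ler_norm_sum _ _ _) _.
  apply: (@le_trans _ _ (\sum_(y <- undup s) `|rho' i y| * (2 * c))).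
    apply: ler_sum => y _; rewrite normrM ler_wpM2l // /jump.
    have [h1 h2] := fc y; have := ler_normB (f (b y)) (f (a y)); lra.
  rewrite -mulr_suml; have := rho'_sum i _ (undup_uniq s).
  have -> : tau * c = tau / 2 * (2 * c) by field.
  by apply: ler_wpM2r; rewrite mulr_ge0.
(* Each summand contributes [tau * c]; for the correction this is mass [tau / 2] against jumps of
   size at most [2 * c]. *)
have S'_le i (f : K -> R) c : 0 <= c -> (forall y, `|f (a y)| <= c /\ `|f (b y)| <= c) ->
    `|S' f i| <= 2 * tau * c.
  move=> c0 fc; apply: le_trans (ler_normD _ _) _.
  have h1 : `|mu i f| <= tau * c by apply: (lift_le (TP i)) => // y; have [] := fc y.
  have h2 : `|Lim (corr i f)| <= tau * c by apply: Lim_le => s; exact: corr_le.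
  have -> : 2 * tau * c = tau * c + tau * c by ring.
  exact: lerD.
have S'P i : bounded_functional (fun f => S' f i) (2 * tau).
  split; first by rewrite mulr_ge0 ?(tau0 i).
    move=> c f g cf cg; rewrite /S'; have [_ lin _] := lift_functional (TP i).
    have bnd (h : K -> R) : continuous h -> exists B, forall s, `|corr i h s| <= B.
      move=> ch; have [B hB] := compact_line_bounded hK ch.
      exists (tau * `|B|) => s; apply: corr_le => // y.
      by split; rewrite (le_trans (hB _)) ?ler_norm.
    have [Bf fB] := bnd _ cf; have [Bg gB] := bnd _ cg.
    rewrite /mu lin //.
    have -> : corr i (fun x => c * f x + g x) = (fun s => c * corr i f s + corr i g s).
      apply/funext => s; rewrite /corr mulr_sumr -big_split; apply: eq_bigr => y _.
      by rewrite /jump /=; ring.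
    by rewrite (Lim_linear _ fB gB); ring.
  by move=> f c _ c0 fc; apply: S'_le.
have S'T g : continuous g -> S' (g \o phi) = T g.
  move=> cg; apply/funext => i; rewrite /S' /mu (lift_comp (TP i)) //.
  rewrite (@Lim_eventually _ 0 0 [::]) ?addr0 // => s *; rewrite /corr big1 ?normr0 // => y _;
  by rewrite /jump /= phi_rightE phi_leftE subrr mulr0.
have jump_ind y z : (a y < b y)%O -> jump (ind y) z = (z == y)%:R.
  move=> yQ; rewrite /jump ind_right // ind_left // le_eqVlt eq_sym.
  by case: eqVneq => [->|_] /=; rewrite ?ltxx ?subr0 ?subrr.
have S'_ind y : (a y < b y)%O -> in_c0 (S' (ind y)).
  move=> yQ.
  (* Only the jump over [y] is seen, so the correction is exactly [rho' i y], whereas [rho i y]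
     would restore [S]. *)
  have E i : S' (ind y) i = S (ind y) i + - 1 * (rho i y - rho' i y).
    rewrite /S' (@Lim_eventually _ (tau * 1) (rho' i y) [:: y]).
    - by rewrite /rho yQ; ring.
    - move=> s; apply: corr_le => // z; rewrite ind_left // ind_right //.
      by split; [case: (y < z)%O|case: (y <= z)%O]; rewrite ?normr1 ?normr0.
    move=> s ys; rewrite /corr (bigD1_seq y) ?undup_uniq //=; last first.
      by rewrite mem_undup ys ?mem_head.
    rewrite jump_ind // eqxx mulr1 big1 ?addr0 // => z zy.
    by rewrite jump_ind // (negPf zy) mulr0.
  rewrite (_ : S' (ind y) = fun i => S (ind y) i + - 1 * (rho i y - rho' i y)); last exact/funext.
  apply: in_c0D; first exact: Sc0.
  by apply: in_c0Z => e e0; exact: rho'_near.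
exists S'; split=> // f cf e e0.
have t1 : 0 < 2 * tau + 1 by rewrite ltr_wpDl // mulr_ge0 ?(tau0 i0).
have e1 : 0 < e / 2 / (2 * tau + 1) by rewrite !divr_gt0.
have e2 : 0 < e / 2 by rewrite divr_gt0.
(* [S'] maps the approximant [h] into c_0, and [S'_le] bounds the remainder uniformly in [i]. *)
have [g [s [cg sQ fgs]]] := approximation cf e1.
pose h x := g (phi x) + \sum_(y <- s) jump f y * ind y x.
have cgphi : continuous (g \o phi).
  by move=> x; apply: continuous_comp; [exact: phi_cont|exact: cg].
have csum : continuous (fun x => \sum_(y <- s) jump f y * ind y x) by exact: continuous_sumZ.
have ch : continuous h by move=> x; apply: cvgD; [exact: cgphi|exact: csum].
have hc0 : in_c0 (S' h).
  have -> : S' h = fun i => T g i + \sum_(y <- s) jump f y * S' (ind y) i.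
    apply/funext => i; rewrite -(S'T g cg) -(functional_sumZ (S'P i)) //.
    by rewrite -(functionalD (S'P i)).
  apply: in_c0D; first exact: Tc0.
  by apply: in_c0_sum => y /sQ yQ; apply/in_c0Z/S'_ind.
apply: sub_finite_set (hc0 _ e2) => i /= eS.
have : `|S' (fun x => f x - h x) i| <= e / 2.
  apply: (@le_trans _ _ (2 * tau * (e / 2 / (2 * tau + 1)))).
    by apply: S'_le; [exact: ltW|move=> y; split; apply: (fgs y); [left|right]].
  by rewrite mulrA ler_pdivrMr // mulrC ler_wpM2l ?(ltW e2) // lerDl.
rewrite (functionalB (S'P i)) //.
by have := lerB_dist (S' f i) (S' h i); lra.
Qed.

End Operators.

End Fibres.

(** * Operator norms and coordinate functionals *)

Section OperatorNorm.
Set Implicit Arguments.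
Unset Strict Implicit.
Context {R : realType}.

Lemma ler_supnorm (X : Type) (f : X -> R) (B : R) x :
  (forall x, `|f x| <= B) -> `|f x| <= supnorm f.
Proof.
move=> fB; apply: ub_le_sup; last by exists x.
by exists B => _ [y _ <-].
Qed.

(** On an empty domain the supremum is 0 by convention, hence [0 <= c]. *)
Lemma supnorm_le (X : Type) (f : X -> R) (c : R) : 0 <= c ->
  (forall x, `|f x| <= c) -> supnorm f <= c.
Proof.
move=> c0 fc; rewrite /supnorm; set A := [set _ | _ in _].
have [->|/set0P A0] := eqVneq A set0; first by rewrite sup0.
by apply: ge_sup => // _ [x _ <-].
Qed.

Lemma supnorm_empty (X : Type) (f : X -> R) : ~ (exists x : X, True) -> supnorm f = 0.
Proof.
move=> nX; rewrite /supnorm; suff -> : [set `|f x| | x in [set: X]] = set0 by rewrite sup0.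
by rewrite -subset0 => t [x _ _]; apply: nX; exists x.
Qed.

Lemma supnorm_ge0 (X : Type) (f : X -> R) (B : R) :
  (forall x, `|f x| <= B) -> 0 <= supnorm f.
Proof.
move=> fB; have [[x _]|nX] := pselect (exists x : X, True).
  exact: le_trans (ler_supnorm x fB).
by rewrite supnorm_empty.
Qed.

Lemma in_c0_bounded (I : Type) (u : I -> R) : in_c0 u -> exists B, forall i, `|u i| <= B.
Proof.
move=> /(_ 1 ltr01) /(finite_image (fun i => `|u i|)) /finite_seqP [s sE].
exists (1 + \sum_(v <- s) `|v|) => i; have [u1|/ltW u1] := leP 1 `|u i|; last first.
  by rewrite ler_wpDr // sumr_ge0.
have us : `|u i| \in s.
  have : [set` s] `|u i| by rewrite -sE; exists i.
  by [].
rewrite (big_rem _ us) /= normr_id addrCA lerDl addr_ge0 // sumr_ge0 //.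
Qed.

Context {K : topologicalType} {I : Type}.
Hypothesis Kbounded : forall f : K -> R, continuous f -> exists B, forall x, `|f x| <= B.
Implicit Types (T : (K -> R) -> I -> R).

Lemma supnorm_le_opnorm T f : bdd_lin_op_C_c0 T -> continuous f ->
  (forall x, `|f x| <= 1) -> supnorm (T f) <= opnorm T.
Proof.
move=> [_ _ [M TM]] cf f1; apply: ub_le_sup; last first.
  by exists f; split=> //; exact: supnorm_le.
(* The sign of [M] is not known, hence the absolute value. *)
exists `|M| => _ [g [cg g1 ->]]; apply: le_trans (TM g cg) _.
apply: le_trans (ler_norm _) _; rewrite normrM ler_piMr //.
by have [B gB] := Kbounded cg; rewrite ger0_norm // (supnorm_ge0 gB).
Qed.

(** Scaling [f] by [c^-1] reduces to the unit ball; for [c = 0] the function is zero. *)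
Lemma opnorm_functional T : bdd_lin_op_C_c0 T ->
  forall i, bounded_functional (fun f => T f i) (opnorm T).
Proof.
move=> TP i; have [c0T lin _] := TP.
have le1 f : continuous f -> (forall x, `|f x| <= 1) -> `|T f i| <= opnorm T.
  move=> cf f1; apply: le_trans (supnorm_le_opnorm TP cf f1).
  by have [B TB] := in_c0_bounded (c0T f cf); exact: ler_supnorm TB.
have cz : continuous (fun _ : K => 0 : R) := @continuous_cst_fun R K 0.
have T0 : T (fun=> 0) i = 0.
  have E := congr1 (@^~ i) (lin (- 1) _ _ cz cz).
  by rewrite -[RHS](addNr (T (fun=> 0) i)) -mulN1r -[RHS]E; congr (T _ i); apply/funext => x; rewrite mulr0 addr0.
split.
- by apply: le_trans (le1 _ cz _) => // x; rewrite normr0.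
- by move=> c f g cf cg; rewrite lin.
move=> f c cf; rewrite le_eqVlt => /predU1P[<-|c0] fc.
  have -> : f = fun=> 0 by apply/funext => x; apply/eqP; rewrite -normr_le0.
  by rewrite T0 normr0 mulr0.
have cf' : continuous (fun x => c^-1 * f x + 0) by exact: continuous_scaleD.
have := le1 _ cf'; rewrite lin //= T0 addr0 normrM normfV (gtr0_norm c0).
rewrite mulrC ler_pdivrMr //; apply => x.
by rewrite addr0 normrM normfV (gtr0_norm c0) mulrC ler_pdivrMr // mul1r.
Qed.

Lemma opnorm_ge0 T : bdd_lin_op_C_c0 T -> 0 <= opnorm T.
Proof.
move=> TP; have [[i _]|nI] := pselect (exists i : I, True).
  by have [] := opnorm_functional TP i.
have cz : continuous (fun _ : K => 0 : R) := @continuous_cst_fun R K 0.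
rewrite -(supnorm_empty (T (fun=> 0)) nI); apply: supnorm_le_opnorm => // x.
by rewrite normr0.
Qed.

Lemma functionals_opnorm T (m : R) : 0 <= m ->
  (forall i, bounded_functional (fun f => T f i) m) ->
  (forall f, continuous f -> in_c0 (T f)) ->
  bdd_lin_op_C_c0 T /\ opnorm T <= m.
Proof.
move=> m0 TP Tc0.
have Tle f c : continuous f -> supnorm f <= c -> supnorm (T f) <= m * c.
  move=> cf fc; have [B fB] := Kbounded cf.
  have f0 := supnorm_ge0 fB.
  have c0 := le_trans f0 fc.
  apply: supnorm_le; first exact: mulr_ge0.
  move=> i; have [_ _ bd] := TP i; apply: bd => // x.
  exact: le_trans (ler_supnorm x fB) fc.
split.
  split=> //; last by exists m => f cf; exact: Tle.
  by move=> c f g cf cg; apply/funext => i; have [_ -> //] := TP i.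
apply: ge_sup => [|_ [f [cf f1 ->]]]; last by rewrite -[m]mulr1; exact: Tle.
exists (supnorm (T (fun=> 0))), (fun=> 0); split=> //; first exact: continuous_cst_fun.
by apply: supnorm_le => // x; rewrite normr0.
Qed.

End OperatorNorm.

Theorem theorem2p26 (R : realType)
  (dK dL : Order.disp_t) (K : orderTopologicalType dK) (L : orderTopologicalType dL)
  (hK : compact [set: K]) (hL : compact [set: L])
  (phi : K -> L) (phi_cont : continuous phi)
  (phi_incr : {homo phi : x y / (x <= y)%O}) (phi_surj : forall y : L, exists x, phi x = y)
  (I : Type) (T : (L -> R) -> (I -> R)) (hT : bdd_lin_op_C_c0 T) :
  (exists S : (K -> R) -> (I -> R),
      bdd_lin_op_C_c0 S /\ forall g : L -> R, inC g -> S (comp_op phi g) = T g) ->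
  exists S' : (K -> R) -> (I -> R),
      [/\ bdd_lin_op_C_c0 S',
          (forall g : L -> R, inC g -> S' (comp_op phi g) = T g) &
          opnorm S' <= 2 * opnorm T].
Proof.
move=> [S [hS ST]].
have bK := fun f : K -> R => @compact_line_bounded R dK K hK f.
have bL := fun f : L -> R => @compact_line_bounded R dL L hL f.
have [ab abP] := fibre_endpoints hK phi_cont phi_surj.
(* Separating functions are chosen for all pairs at once, with the zero function as dummy when the
   pair is not increasing; likewise for [ind] on one-point fibres. *)
have /choice [k kP] (p : L * L) : exists f : L -> R, continuous f /\
    ((p.1 < p.2)%O -> [/\ (forall t, 0 <= f t <= 1),
      (forall t, (t <= p.1)%O -> f t = 0) & (forall t, (p.2 <= t)%O -> f t = 1)]).
  have [lt_p|_] := boolP (p.1 < p.2)%O; last first.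
    by exists (fun=> 0); split; [exact: continuous_cst_fun|].
  by have [f [cf f01 f0 f1]] := @compact_line_separation R _ _ hL _ _ lt_p; exists f.
have /choice [ind indP] (y : L) : exists f : K -> R, continuous f /\
    (((ab y).1 < (ab y).2)%O -> [/\ (forall x, 0 <= f x <= 1),
      (forall x, (x <= (ab y).1)%O -> f x = 0) & (forall x, ((ab y).2 <= x)%O -> f x = 1)]).
  have [lt_y|_] := boolP ((ab y).1 < (ab y).2)%O; last first.
    by exists (fun=> 0); split; [exact: continuous_cst_fun|].
  by have [f [cf f01 f0 f1]] := @compact_line_separation R _ _ hK _ _ lt_y; exists f.
have [Lim [Lim_linear Lim_near]] := @generalized_limit R L.
have [hT0 _ _] := hT; have [hS0 _ _] := hS.
have [||||||||S' [S'P S'c0 S'T]] := @extension_le_twice R dK dL K L hK hL phi phi_cont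
    phi_incr ab abP (fun u v => k (u, v)) ind _ _ _ _ _ _ _ _ Lim Lim_linear Lim_near
    I T S (opnorm T) (opnorm S) (opnorm_functional bL hT) hT0 (opnorm_functional bK hS) hS0 ST.
- by move=> u v; have [] := kP (u, v).
- by move=> u v t uv; have [_ /(_ uv)[]] := kP (u, v).
- by move=> u v t uv tu; have [_ /(_ uv)[_ /(_ t tu)]] := kP (u, v).
- by move=> u v t uv vt; have [_ /(_ uv)[_ _ /(_ t vt)]] := kP (u, v).
- by move=> y; have [] := indP y.
- by move=> y x yQ; have [_ /(_ yQ)[]] := indP y.
- by move=> y x yQ xa; have [_ /(_ yQ)[_ /(_ x xa)]] := indP y.
- by move=> y x yQ bx; have [_ /(_ yQ)[_ _ /(_ x bx)]] := indP y.
have m0 : 0 <= 2 * opnorm T by rewrite mulr_ge0 // (opnorm_ge0 bL hT).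
have [S'b S'n] := functionals_opnorm bK m0 S'P S'c0.
by exists S'; split.
Qed.
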